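(* Let $h^*$ be the unique real polynomial of degree at most $2$ minimizing $\max_{t\in[0,1]}\left|h(t)-(1+t^3)^{1/3}\right|$ among all real polynomials $h$ of degree at most $2$, and let $k$ be its first interior alternation point. Then the minimal polynomial of $k$ over $\mathbb{Q}$ has degree $246$.
   Context: The optimal error $d(t)=h^*(t)-(1+t^3)^{1/3}$ attains its maximum absolute value on $[0,1]$ with alternating signs at four points $0,t_1,t_2,1$ with $0<t_1<t_2<1$. The first interior alternation point (the ''absolute equiripple parameter'') is $k=t_1$. *)

(* Defs.v *)
From HB Require Import structures.
From mathcomp Require Import all_boot all_order all_algebra.
From mathcomp Require Import classical_sets set_interval reals exp.

Set Implicit Arguments.
Unset Strict Implicit.
Unset Printing Implicit Defensive.

Import Order.TTheory GRing.Theory Num.Theory.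
Local Open Scope classical_set_scope.
Local Open Scope ring_scope.

Definition target (R : realType) (t : R) : R := (1 + t ^+ 3) `^ 3^-1.

Definition error (R : realType) (h : {poly R}) (t : R) : R :=
  h.[t] - target t.

(* The error is continuous on the compact interval [0, 1], so this supremum
   is the maximum of its absolute value there. *)
Definition max_error (R : realType) (h : {poly R}) : R :=
  sup [set `|error h t| | t in `[0, 1]].

(* size h <= 3 means degree at most 2. *)
Definition best_quadratic (R : realType) (h : {poly R}) : Prop :=
  (size h <= 3)%N /\
  forall g : {poly R}, (size g <= 3)%N -> max_error h <= max_error g.

(* t1 is the first interior point of an alternation 0 < t1 < t2 < 1; the
   boolean s fixes the sign of the error at 0. *)
Definition first_interior_alternation_point (R : realType) (h : {poly R})
    (t1 : R) : Prop :=
  exists (t2 : R) (s : bool),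
    [/\ 0 < t1, t1 < t2 & t2 < 1] /\
    [/\ error h 0 = (-1) ^+ s * max_error h,
        error h t1 = - ((-1) ^+ s * max_error h),
        error h t2 = (-1) ^+ s * max_error h &
        error h 1 = - ((-1) ^+ s * max_error h)].

Definition minimal_polynomial (R : realType) (x : R) (p : {poly rat}) : Prop :=
  [/\ p \is monic,
      root (map_poly ratr p) x &
      forall q : {poly rat}, q != 0 -> root (map_poly ratr q) x ->
        (size p <= size q)%N].

(* Main.v *)
(* Write h = 1 + e + b t + c t^2, with e the signed error, th = 2^(1/3), f for the target
   and y = f(k). The conditions at 0 and at the second alternation point t2 say that
   1 + b t + c t^2 is tangent to the curve y^3 = 1 + t^3 at t2, so that (b, c) lies on a
   discriminant curve D = 0; those at 1 and at k express b and c rationally in k, y, th.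
   Taking the norm of D over y and dividing by the spurious factors gives a polynomial
   equation G(k) = 0 of degree 82 over Z[th].

   G is irreducible over Q(th): modulo the prime 3 - 2 th above 11, where th becomes 7, it is
   irreducible over F_11 by Rabin's test. Hence for every f in Q[X] vanishing at k, G
   divides f over Q(th) and, taking norms, N(G) divides f^3. So N(G), of degree 246, is up to
   a constant a power m^j of the minimal polynomial m of k. The 5-adic valuation of
   N(G)(1) is 5 while the leading coefficient is prime to 5, so j divides both 5 and 246. *)

From Stdlib Require Import ZArith.
Require Import Defs.
From HB Require Import structures.
From mathcomp Require Import all_boot all_order all_algebra all_field.
From mathcomp Require Import classical_sets set_interval reals exp.
From mathcomp Require Import boolp topology normedtype derive.
From mathcomp Require Import qpoly zify ssrZ ring lra.

Set Implicit Arguments.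
Unset Strict Implicit.
Unset Printing Implicit Defensive.

Import Order.TTheory GRing.Theory Num.Theory.
Import numFieldNormedType.Exports.
Local Open Scope ring_scope.
Delimit Scope Z_scope with coqZ.

Local Arguments Z.mul : simpl never.
Local Arguments Z.add : simpl never.
Local Arguments Z.opp : simpl never.

(** * The ring Z[2^(1/3)] *)

Record Zcbrt2 := ZC { zc0 : Z; zc1 : Z; zc2 : Z }.

Definition tuple_of_Zcbrt2 x := (zc0 x, zc1 x, zc2 x).
Definition Zcbrt2_of_tuple '(a, b, c) := ZC a b c.
Lemma tuple_of_Zcbrt2K : cancel tuple_of_Zcbrt2 Zcbrt2_of_tuple.
Proof. by case. Qed.

HB.instance Definition _ := Countable.copy Zcbrt2 (can_type tuple_of_Zcbrt2K).

Local Notation "x +! y" := (Z.add x y) (at level 50, left associativity).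
Local Notation "x *! y" := (Z.mul x y) (at level 40, left associativity).

Definition Zcbrt2_add x y :=
  let: ZC a b c := x in let: ZC a' b' c' := y in
  ZC (a +! a') (b +! b') (c +! c').
Definition Zcbrt2_opp x :=
  let: ZC a b c := x in ZC (Z.opp a) (Z.opp b) (Z.opp c).
Definition Zcbrt2_mul x y :=
  let: ZC a b c := x in let: ZC a' b' c' := y in
  ZC (a *! a' +! Z.double (b *! c' +! c *! b'))
     (a *! b' +! b *! a' +! Z.double (c *! c'))
     (a *! c' +! b *! b' +! c *! a').

Lemma ZC_eq (a b c a' b' c' : Z) :
  a = a' -> b = b' -> c = c' -> ZC a b c = ZC a' b' c'.
Proof. by move=> -> -> ->. Qed.

Ltac cbrt2 := do ?case=> ? ? ?; apply: ZC_eq; rewrite ?Z.double_spec; lia.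

Fact Zcbrt2_addA : associative Zcbrt2_add. Proof. cbrt2. Qed.
Fact Zcbrt2_addC : commutative Zcbrt2_add. Proof. cbrt2. Qed.
Fact Zcbrt2_add0 : left_id (ZC 0 0 0) Zcbrt2_add. Proof. cbrt2. Qed.
Fact Zcbrt2_addN : left_inverse (ZC 0 0 0) Zcbrt2_opp Zcbrt2_add.
Proof. cbrt2. Qed.
HB.instance Definition _ := GRing.isZmodule.Build Zcbrt2
  Zcbrt2_addA Zcbrt2_addC Zcbrt2_add0 Zcbrt2_addN.

Fact Zcbrt2_mulA : associative Zcbrt2_mul. Proof. cbrt2. Qed.
Fact Zcbrt2_mulC : commutative Zcbrt2_mul. Proof. cbrt2. Qed.
Fact Zcbrt2_mul1 : left_id (ZC 1 0 0) Zcbrt2_mul. Proof. cbrt2. Qed.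
Fact Zcbrt2_mulDl : left_distributive Zcbrt2_mul Zcbrt2_add. Proof. cbrt2. Qed.
Fact Zcbrt2_1neq0 : ZC 1 0 0 != ZC 0 0 0. Proof. by []. Qed.
HB.instance Definition _ := GRing.Zmodule_isComNzRing.Build Zcbrt2
  Zcbrt2_mulA Zcbrt2_mulC Zcbrt2_mul1 Zcbrt2_mulDl Zcbrt2_1neq0.

(** * Coefficient lists, lowest degree first, as computable polynomials *)

Section SeqPoly.
Variable B : comNzRingType.
Implicit Types s t : seq B.

Fixpoint seq_add s t :=
  match s, t with
  | x :: s', y :: t' => x + y :: seq_add s' t'
  | [::], _ => t
  | _, [::] => s
  end.
Definition seq_scale (a : B) s := map (fun x => a * x) s.
Definition seq_mul s t := foldr (fun x r => seq_add (seq_scale x t) (0 :: r)) [::] s.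

Variables (A : comNzRingType) (phi : {rmorphism B -> A}) (x : A).

(** With an arbitrary target ring, one list calculus serves both extensions of F_11 and the
    reals. *)
Definition seq_eval s := foldr (fun c r => phi c + x * r) 0 s.

Lemma seq_eval_add s t : seq_eval (seq_add s t) = seq_eval s + seq_eval t.
Proof.
elim: s t => [|a s IH] [|b t] /=; rewrite ?add0r ?addr0 //.
by rewrite IH rmorphD mulrDr addrACA.
Qed.

Lemma seq_eval_scale a s : seq_eval (seq_scale a s) = phi a * seq_eval s.
Proof.
elim: s => [|b s IH] /=; first by rewrite mulr0.
by rewrite IH rmorphM mulrDr mulrCA.
Qed.

Lemma seq_eval_mul s t : seq_eval (seq_mul s t) = seq_eval s * seq_eval t.
Proof.
elim: s => [|a s IH] /=; first by rewrite mul0r.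
by rewrite seq_eval_add /= IH seq_eval_scale rmorph0 add0r mulrDl mulrA.
Qed.

Lemma seq_evalE s : seq_eval s = (map_poly phi (Poly s)).[x].
Proof.
elim: s => [|a s IH] /=; first by rewrite rmorph0 horner0.
by rewrite cons_poly_def rmorphD rmorphM /= map_polyX map_polyC /= hornerMXaddC
  -IH addrC mulrC.
Qed.

End SeqPoly.

(* G, lowest degree first; it is obtained by elimination, see [ynorm_Dy]. *)
Definition G_seq : seq Zcbrt2 :=
  [:: ZC (-2125125) (-2125125) (-2125125); ZC 69142200 70558950 64727100;
   ZC (-1110879961) (-1435487703) (-714762090); ZC 15334791922 12221056482 6136068714;
   ZC (-120359714323) (-70997811540) (-49922956665); ZC 626922202012 322691782002 332582284410;
   ZC (-2294089963765) (-1349756251107) (-1630698660153);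
   ZC 6246915780166 5211698203530 5823125705202;
   ZC (-13622932946773) (-17548842188838) (-14789528162370);
   ZC 28210560283396 47115133278114 25022854858404;
   ZC (-67515682329631) (-92501783801109) (-20357228040318);
   ZC 170551289745034 105444167059914 (-15429427086102);
   ZC (-346152213325474) 34910597261955 45399232385574;
   ZC 394103506240996 (-434074227219396) 76385101001934;
   ZC 253525635462854 888987696226350 (-476871430940949);
   ZC (-2190052844453216) (-632854796209512) 851124720187872;
   ZC 4719434609877338 (-1188553451582160) (-96646200302181);
   ZC (-4642187087392820) 3856350003470088 (-2911087684863162);
   ZC (-2309100727944952) (-3595119730013544) 7076332414326369;
   ZC 15362320049689576 (-4246874463949572) (-7232903294367708);
   ZC (-23322021186171738) 17898301947832932 (-2737242591992007);
   ZC 9301204597196628 (-22573496767614744) 21263640130882674;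
   ZC 28798649763190860 (-1832579133082914) (-32371115450913699);
   ZC (-61744465692380208) 55791765450838368 15265880218817532;
   ZC 42193155753764778 (-96688402399135116) 30558031042591305;
   ZC 42645661854947700 58718016460302840 (-67592675526462846);
   ZC (-132289589225053032) 81032983511959458 45558371377232199;
   ZC 123288275578113672 (-236327323112724384) 39357978124495176;
   ZC 25091382744463740 248324084939153166 (-108463569721555095);
   ZC (-219364391238582356) (-22205747240851404) 59781710627274114;
   ZC 284947985294539862 (-325562921601622800) 110074658570329917;
   ZC (-128942040135324980) 510928429639161948 (-243225713320320960);
   ZC (-160134849923664853) (-306355537448970189) 139336783550166486;
   ZC 379110155315663692 (-201745803892120734) 217413790795029114;
   ZC (-390932502177887587) 632226020824541781 (-551824382120447193);
   ZC 208343883771643270 (-606608174985103770) 487838080354549446;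
   ZC 64126138171792937 105135996099950412 74842962406253250;
   ZC (-347204253890927192) 485077194914937822 (-776102276936863404);
   ZC 563144631501070085 (-695642228217521115) 1020829500724243668;
   ZC (-591861278635277918) 370349678705332614 (-510313197669065358);
   ZC 287997679745054627 195061343681297322 (-460011029655565119);
   ZC 298911877737904408 (-550809923972410338) 1173087882561514890;
   ZC (-857295729200444665) 445583577988890051 (-1098688584130949277);
   ZC 954079735218072718 (-39797908095064698) 295170545742205206;
   ZC (-451358860878453346) (-321532310793612705) 626700704252973453;
   ZC (-353017547132188592) 370477987462439232 (-1046877502496477160);
   ZC 895063557287868308 (-149844353735301630) 764057655569732868;
   ZC (-839498714517903420) (-126466522292972100) (-102133896354888816);
   ZC 292941541970768832 238866730683615930 (-450389057109181776);
   ZC 297858604271716800 (-161028651344946720) 589487532037361052;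
   ZC (-562666047443765604) (-3068788206145734) (-368067484315857906);
   ZC 429296239357776720 109835499633627564 33808407853449564;
   ZC (-113056750368072324) (-111740034431293380) 182348784343363770;
   ZC (-138195276884505000) 42982485088317192 (-214118164640352024);
   ZC 205305571047310164 22873264371571176 125565963638723604;
   ZC (-135788625273136824) (-47535013652419440) (-20865305994566976);
   ZC 32118498100984536 33414677981874720 (-39079655911605924);
   ZC 30548769936900192 (-8086061905909704) 47835946828400184;
   ZC (-42420077578052424) (-8439436480290912) (-29848196422588968);
   ZC 25979759017872048 11194105823907552 9272528720355384;
   ZC (-7632595705997952) (-6618287186853048) 2582243839909368;
   ZC (-2329669380961008) 1509752780222544 (-5655071337266448);
   ZC 4132944516891024 987415933564584 4241521612140696;
   ZC (-2687960543221584) (-1305075132461808) (-1951973190056016);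
   ZC 960049516858128 758569341032352 444208359937104;
   ZC (-115653509494848) (-260823792072672) 165706751113344;
   ZC (-121152122277408) 22017308761728 (-239406294994416);
   ZC 81706824855936 33638114548800 149739580355472;
   ZC (-24441304138416) (-26664445547856) (-59705385359760);
   ZC (-6862470162336) 11074261643712 15174312059520;
   ZC 9818339475600 (-2976997226256) 206630221104;
   ZC (-6125466123360) 73498176576 (-2238268318848); ZC 2053854530208 319650415344 1472858384688;
   ZC (-361525353408) (-208336069440) (-567445948416);
   ZC (-155522877120) 66642264000 174447297216; ZC 147025839744 (-15793009344) (-32844470976);
   ZC (-77773592448) 1782632448 3644906688; ZC 27760273344 (-115893504) 644972544;
   ZC (-8076433536) (-7138368) (-211631616); ZC 1715727744 0 30233088; ZC (-279656064) 0 0;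
   ZC 27713664 0 0; ZC (-1259712) 0 0]%coqZ.

Definition ZtoC (z : Z) : Zcbrt2 := ZC z 0 0.

(** * Irreducibility modulo 11 *)

(* Reduction at the prime of degree 1 above 11, since 7^3 = 2 modulo 11. *)
Definition rhoZ (x : Zcbrt2) : Z := let: ZC a b c := x in (a + 7 * b + 49 * c)%coqZ.
Definition mod11 (s : seq Z) := [seq Z.modulo z 11 | z <- s].
Definition G11_seq := Eval vm_compute in mod11 (map rhoZ G_seq).
(* X^82 modulo G: the exponent 9 inverts the leading coefficient modulo 11. *)
Definition G11_tail := Eval vm_compute in
  mod11 (seq_scale (-(last 0 G11_seq)^9)%coqZ (take 82 G11_seq)).
Definition mulX_G11 s := let t := 0%coqZ :: s in
  mod11 (seq_add (take 82 t) (seq_mul (drop 82 t) G11_tail)).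
Arguments mulX_G11 : simpl never.

(* The matrix of the Frobenius: its rows are X^(11 j) modulo G. *)
Fixpoint frob_rows_from r n :=
  if n is n'.+1 then r :: frob_rows_from (iter 11 mulX_G11 r) n' else [::].
Definition frob_rows := Eval vm_compute in frob_rows_from [:: 1%coqZ] 82.
Fixpoint seq_comb (s : seq Z) (t : seq (seq Z)) :=
  match s, t with
  | c :: s', r :: t' => seq_add (seq_scale c r) (seq_comb s' t')
  | _, _ => [::]
  end.
(** Coefficients in F_11 are fixed by the 11th power, so s^11 is the combination of the rows X^(11
    j) with the coefficients of s itself. *)
Definition frob11 s := mod11 (seq_comb s frob_rows).
Definition reduce_G11 s := foldr (fun c r => seq_add [:: c] (mulX_G11 r)) [::] s.
Definition seqX := [:: 0; 1]%coqZ.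

(* The inverse of (X^(11^41) - X) (X^(11^2) - X) modulo G. *)
Definition inverse_certificate : seq Z :=
  [:: 6; 2; 5; 4; 4; 4; 1; 3; 8; 7; 10; 3; 1; 4; 8; 7; 6; 1; 1; 10; 6; 2; 2; 8; 4; 9; 1;
   7; 4; 7; 5; 2; 10; 0; 8; 0; 1; 4; 5; 7; 4; 4; 6; 5; 3; 1; 7; 9; 7; 3; 9; 4; 0; 10; 10;
   5; 8; 9; 6; 8; 8; 1; 6; 2; 0; 10; 3; 6; 7; 3; 5; 6; 7; 10; 5; 10; 5; 6; 1; 1; 4; 6]%coqZ.

Definition frob_iter n := iter n frob11 seqX.
Definition sub_X s := seq_add s [:: 0; -1]%coqZ.
Definition vanishes11 s := all (Z.eqb 0) (mod11 s).
Definition sub_1 s := seq_add s [:: -1]%coqZ.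

(** Rabin's test in degree 82 = 2 * 41. The 82nd Frobenius iterate returns to X, while the 41st and
    the 2nd differ from X by units modulo G; one inverse of the product of the differences covers
    both. The sizes keep each iterate within the 82 rows of the matrix. *)
Lemma frob_iter_checks :
  [&& all (fun s : seq Z => size s <= 82)%N (traject frob11 seqX 82),
      vanishes11 (sub_X (frob_iter 82)) &
      vanishes11 (sub_1 (reduce_G11 (seq_mul inverse_certificate
        (reduce_G11 (seq_mul (sub_X (frob_iter 41)) (sub_X (frob_iter 2)))))))].
Proof. by vm_cast_no_check isT. Qed.

Lemma rmorphZ_int (L : comNzRingType) (phi : {rmorphism Z -> L}) (z : Z) :
  phi z = (int_of_Z z)%:~R.
Proof. by rewrite -{1}[z]int_of_ZK Instances.Z_of_intE rmorph_int. Qed.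

Section Place11.
Variables (L : fieldType) (phi : {rmorphism Z -> L}) (x : L).
Hypothesis (L11 : 11%N \in [pchar L]) (gx0 : seq_eval phi x G11_seq = 0).
Local Notation ev := (seq_eval phi x).

Lemma phi11 : phi 11%coqZ = 0.
Proof. by rewrite -[11%coqZ]/(11%:R : Z) rmorph_nat (pcharf0 L11). Qed.

Lemma phiN1 : phi (-1)%coqZ = -1.
Proof. exact: (rmorphN1 phi). Qed.

Lemma phi_mod z : phi (Z.modulo z 11) = phi z.
Proof.
rewrite [in RHS](Z.div_mod z 11 (fun e => ltac:(discriminate e))).
by rewrite (rmorphD phi) (rmorphM phi) phi11 mul0r add0r.
Qed.

Lemma phi_pow11 z : phi z ^+ 11 = phi z.
Proof. by rewrite rmorphZ_int -(pFrobenius_autE L11) rmorph_int. Qed.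

Lemma ev_mod s : ev (mod11 s) = ev s.
Proof. by elim: s => //= c s ->; rewrite phi_mod. Qed.

Lemma ev_cat s t : ev (s ++ t) = ev s + x ^+ size s * ev t.
Proof.
elim: s => [|c s IH] /=; first by rewrite mul1r add0r.
by rewrite IH exprS mulrDr mulrA addrA.
Qed.

Lemma ev_vanishes11 s : vanishes11 s -> ev s = 0.
Proof.
rewrite -ev_mod /vanishes11; elim: (mod11 s) => //= c {}s IH.
move=> /andP[/(Z.eqb_eq 0 c) <- /IH->].
by rewrite rmorph0 mulr0 addr0.
Qed.

Lemma ev_G11_tail : x ^+ 82 = ev G11_tail.
Proof.
(* Made monic, G cancels modulo 11 against the tail minus X^82. *)
have : vanishes11 (seq_add (seq_scale (last 0 G11_seq ^+ 9) G11_seq)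
                     (G11_tail ++ [:: (-1)%coqZ])).
  by vm_compute.
move/ev_vanishes11; rewrite seq_eval_add seq_eval_scale gx0 mulr0 add0r ev_cat.
have -> : ev [:: (-1)%coqZ] = -1 by rewrite /= phiN1 mulr0 addr0.
by rewrite mulrN1 => /eqP; rewrite subr_eq0 => /eqP ->.
Qed.

Lemma ev_mulX_G11 s : ev (mulX_G11 s) = x * ev s.
Proof.
rewrite /mulX_G11; set t := _ :: s; rewrite ev_mod seq_eval_add seq_eval_mul -ev_G11_tail.
have -> : x * ev s = ev t by rewrite /= rmorph0 add0r.
rewrite -[in RHS](cat_take_drop 82 t) ev_cat size_take; case: ltnP => // ht.
  by rewrite mulrC.
by rewrite drop_oversize //= !mulr0 mul0r.
Qed.

Lemma ev_iter_mulX n s : ev (iter n mulX_G11 s) = x ^+ n * ev s.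
Proof.
elim: n => [|n IH]; first by rewrite mul1r.
by rewrite iterS ev_mulX_G11 IH exprS mulrA.
Qed.

(** In characteristic 11, (c + x s)^11 = c + x^11 s^11: peeling off a coefficient multiplies the
    current row by x^11. *)
Lemma ev_frob_rows_from r n s : (size s <= n)%N ->
  ev (seq_comb s (frob_rows_from r n)) = ev r * ev s ^+ 11.
Proof.
elim: n r s => [|n IH] r [|c s] //; rewrite ?expr0n ?mulr0 //.
rewrite -[seq_comb _ _]/(seq_add (seq_scale c r)
  (seq_comb s (frob_rows_from (iter 11 mulX_G11 r) n))) [ev (c :: s)]/=.
rewrite ltnS => /IH {}IH; rewrite seq_eval_add seq_eval_scale IH.
have -> : (phi c + x * ev s) ^+ 11 = phi c + x ^+ 11 * ev s ^+ 11.
  have := rmorphD (pFrobenius_aut L11) (phi c) (x * ev s).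
  by rewrite rmorphM /= !pFrobenius_autE phi_pow11.
by rewrite ev_iter_mulX mulrDr mulrC -mulrA mulrCA.
Qed.

Lemma frob_rowsE : frob_rows = frob_rows_from [:: 1%coqZ] 82. Proof. by vm_compute. Qed.

Lemma ev_frob_iter n : (n <= 82)%N -> ev (frob_iter n) = x ^+ (11 ^ n).
Proof.
have /and3P[/all_nthP sz _ _] := frob_iter_checks.
elim: n => [|n IH] ltn82; first by rewrite /= rmorph0 rmorph1 mulr0 addr0 add0r mulr1.
rewrite /frob_iter iterS -/(frob_iter n) ev_mod frob_rowsE ev_frob_rows_from; last first.
  by have := sz seqX n; rewrite size_traject nth_traject //; apply.
by rewrite IH 1?ltnW // /= rmorph1 mulr0 addr0 mul1r -exprM expnSr.
Qed.

Lemma ev_reduce_G11 s : ev (reduce_G11 s) = ev s.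
Proof.
elim: s => // c s IH.
rewrite -[reduce_G11 (c :: s)]/(seq_add [:: c] (mulX_G11 (reduce_G11 s))).
by rewrite seq_eval_add ev_mulX_G11 IH /= mulr0 addr0.
Qed.

Lemma ev_sub_X s : ev (sub_X s) = ev s - x.
Proof.
rewrite seq_eval_add /= phiN1 rmorph0.
by rewrite add0r mulr0 addr0 mulrN1.
Qed.

(* [q] keeps 11 ^ 82 from being evaluated. *)
Lemma frob_orbit (q : nat -> L) : (forall n, q n = x ^+ (11 ^ n)) ->
  [/\ q 82 = x, q 41 != x & q 2 != x].
Proof.
move=> qE; have qc n : (n <= 82)%N -> ev (frob_iter n) = q n.
  by rewrite qE; apply: ev_frob_iter.
have /and3P[_ c82 cinv] := frob_iter_checks.
rewrite -(qc 82%N isT) -(qc 41%N isT) -(qc 2%N isT).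
move: frob_iter c82 cinv {qE qc q} => c.
move/ev_vanishes11; rewrite ev_sub_X => /eqP; rewrite subr_eq0 => /eqP-> /ev_vanishes11.
rewrite seq_eval_add ev_reduce_G11 seq_eval_mul ev_reduce_G11 seq_eval_mul !ev_sub_X.
have -> : ev [:: (-1)%coqZ] = -1 by rewrite /= phiN1 mulr0 addr0.
(* The equation says that y times the product of both differences is 1, so neither difference
   vanishes. *)
move: (ev inverse_certificate) => y /eqP; rewrite subr_eq0 => /eqP h.
by split=> //; apply: contra_eq_neq h => ->;
   rewrite subrr ?mulr0 ?mul0r ?mulr0 eq_sym oner_neq0.
Qed.

End Place11.

(* The n such that x is fixed by the n-th iterate of the Frobenius are the multiples of a
   divisor of 82 which is neither 1, 2 nor 41. *)
Lemma frob_orbit_dvd (L : finFieldType) (phi : {rmorphism Z -> L}) (x : L) d :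
    11%N \in [pchar L] -> seq_eval phi x G11_seq = 0 -> #|L| = (11 ^ d)%N ->
  (82 %| d)%N.
Proof.
move=> L11 gx0 cardL.
have [q qE] : exists q : nat -> L, forall n, q n = x ^+ (11 ^ n) by eexists.
have [q82 q41 q2] := frob_orbit L11 gx0 qE.
have qD a b : q (a + b)%N = q a ^+ (11 ^ b) by rewrite !qE -exprM expnD.
have q_mul a m : q a = x -> q (m * a)%N = x.
  move=> qa; elim: m => [|m IH]; first by rewrite mul0n qE expn0 expr1.
  by rewrite mulSn qD qa -qE.
have qd : q d = x by rewrite qE -cardL expf_card.
(* Bezout, u * 82 = v * d + gcd, transfers the fixed point from 82 and d to their gcd. *)
have [u v e _] := @egcdnP 82 d isT.
have qg : q (gcdn 82 d) = x.
  by have := q_mul _ u q82; rewrite e qD q_mul // -qE.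
have : gcdn 82 d \in divisors 82 by rewrite -dvdn_divisors // dvdn_gcdl.
rewrite (_ : divisors 82 = [:: 1; 2; 41; 82]%N) // !inE.
case/or4P=> /eqP g; rewrite g in qg.
- by have := q_mul _ 2 qg; rewrite muln1 => /eqP; rewrite (negPf q2).
- by move: q2; rewrite qg eqxx.
- by move: q41; rewrite qg eqxx.
- by rewrite -g dvdn_gcdr.
Qed.

Lemma irreducible_polyZ (F : fieldType) (a : F) (p : {poly F}) : a != 0 ->
  irreducible_poly p -> irreducible_poly (a *: p).
Proof.
move=> a0 [szp irr]; split=> [|q szq]; first by rewrite size_scale.
rewrite dvdpZr // => /(irr _ szq) /eqp_trans -> //.
by rewrite eqp_sym eqp_scale.
Qed.

Lemma ex_irreducible_dvd (F : finFieldType) (p : {poly F}) : (1 < size p)%N ->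
  exists h, [/\ irreducible_poly h, h \is monic & h %| p].
Proof.
have [n] := ubnP (size p); elim: n p => // n IH p szp p1.
have p0 : p != 0 by rewrite -size_poly_gt0 (ltn_trans _ p1).
have [/irreducibleP irr|] := boolP (irreducibleb p).
  have lp0 : (lead_coef p)^-1 != 0 by rewrite invr_eq0 lead_coef_eq0.
  exists ((lead_coef p)^-1 *: p); split; first exact: irreducible_polyZ.
    by rewrite monicE lead_coefZ mulVf // lead_coef_eq0.
  by rewrite dvdpZl.
rewrite negb_and p1 /= => /forallPn[q]; rewrite negb_imply -ltnNge => /andP[qp q1].
rewrite -Pdiv.Idomain.dvdpE in qp.
have szq : (size q < n)%N.
  by rewrite (leq_ltn_trans (size_npoly q)) // -ltnS prednK // size_poly_gt0.
by have [h [irr mon /dvdp_trans/(_ qp)]] := IH _ szq q1; exists h.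
Qed.

Definition of_Z (A : comNzRingType) : {rmorphism Z -> A} := intmul 1 \o int_of_Z.

Section RootClass.
Variables (F : finFieldType) (h : {poly F}) (hI : monic_irreducible_poly h).
Local Notation L := {poly %/ h with hI}.

(** Reduction modulo h is evaluation at the class of X; for h dividing G, this class is the root to
    which the Frobenius test is applied. *)
Lemma in_qpoly_seq_eval (s : seq Z) :
  in_qpoly h (Poly (map (of_Z F) s)) = seq_eval (of_Z L) (in_qpoly h 'X : L) s.
Proof.
elim: s => [|c s IH] /=; first by rewrite in_qpoly0.
rewrite cons_poly_def in_qpolyD in_qpolyM IH addrC mulrC; congr (_ + _).
by rewrite /= rmorph_int /=; apply: (rmorph_int (in_qpoly h)).
Qed.

Lemma seq_eval_in_qpolyX (s : seq Z) : h %| Poly (map (of_Z F) s) ->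
  seq_eval (of_Z L) (in_qpoly h 'X : L) s = 0.
Proof.
move=> hs; rewrite -in_qpoly_seq_eval; apply/val_eqP => /=.
by rewrite -Pdiv.IdomainMonic.modpE mk_monicE //; case: hI.
Qed.

End RootClass.

Definition rho11 (x : Zcbrt2) : 'F_11 := of_Z 'F_11 (rhoZ x).

Lemma F11 : 11%N \in [pchar 'F_11]. Proof. exact: pchar_Fp. Qed.

Lemma rho11_zmod : zmod_morphism rho11.
Proof.
move=> x y; rewrite /rho11 -rmorphB; congr (of_Z _ _).
case: x y => [a b c] [a' b' c'].
by rewrite -[_ - _ in LHS]/(Zcbrt2_add _ (Zcbrt2_opp _)) /=; lia.
Qed.

Lemma rho11_monoid : monoid_morphism rho11.
Proof.
split=> [|x y]; first by rewrite /rho11 -[rhoZ _]/(1 : Z) rmorph1.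
rewrite /rho11 -rmorphM; apply/eqP; rewrite -subr_eq0 -rmorphB.
(* The coefficients come from 7^3 = 2 + 11 * 31 and 7^4 = 2 * 7 + 11 * 217. *)
pose z (x y : Zcbrt2) := let: ZC a b c := x in let: ZC a' b' c' := y in
  (- (31 * (b * c' + c * b') + 217 * (c * c')))%coqZ.
have -> : rhoZ (x * y) - rhoZ x * rhoZ y = 11%coqZ * z x y.
  case: x y => [a b c] [a' b' c'].
  have -> : ZC a b c * ZC a' b' c' = Zcbrt2_mul (ZC a b c) (ZC a' b' c') by [].
  by rewrite /= !Z.double_spec; lia.
by rewrite rmorphM (phi11 (of_Z 'F_11) F11) mul0r.
Qed.

HB.instance Definition _ :=
  GRing.isZmodMorphism.Build Zcbrt2 'F_11 rho11 rho11_zmod.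
HB.instance Definition _ :=
  GRing.isMonoidMorphism.Build Zcbrt2 'F_11 rho11 rho11_monoid.

Lemma G_mod11E : map_poly rho11 (Poly G_seq) = Poly (map (of_Z 'F_11) G11_seq).
Proof.
rewrite map_Poly; congr Poly.
have -> : G11_seq = mod11 (map rhoZ G_seq) by vm_compute.
rewrite -!map_comp; apply: eq_map => x.
by rewrite [RHS](phi_mod (of_Z 'F_11) F11).
Qed.

Lemma size_G_mod11 : size (map_poly rho11 (Poly G_seq)) = 83%N.
Proof. by rewrite G_mod11E (@PolyK _ 0) ?size_map. Qed.

(** An irreducible factor h of a nonconstant divisor q gives a field with 11^(deg h) elements
    containing a root of G. Hence 82 divides deg h, and q has full degree. *)
Lemma G_irreducible_mod11 : irreducible_poly (map_poly rho11 (Poly G_seq)).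
Proof.
split=> [|q q1 qG]; first by rewrite size_G_mod11.
have G0 : map_poly rho11 (Poly G_seq) != 0 by rewrite -size_poly_gt0 size_G_mod11.
have q0 : q != 0 by apply: contraTneq qG => ->; rewrite dvd0p.
have {}q1 : (1 < size q)%N by rewrite ltn_neqAle eq_sym q1 size_poly_gt0.
have [h [irr mon hq]] := ex_irreducible_dvd q1.
pose L : finFieldType := {poly %/ h with (irr, mon)}.
have L11 : 11%N \in [pchar L] by rewrite (pchar_lalg L) F11.
have root_h : seq_eval (of_Z L) (in_qpoly h 'X : L) G11_seq = 0.
  by apply: seq_eval_in_qpolyX; rewrite -G_mod11E (dvdp_trans hq).
have cardL : #|L| = (11 ^ (size h).-1)%N.
  by rewrite card_qfpoly card_Fp.
have dvd82 := frob_orbit_dvd L11 root_h cardL.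
move: (map_poly rho11 _) size_G_mod11 G0 qG => g szg g0 qg.
rewrite -(dvdp_size_eqp qg) eqn_leq dvdp_leq //= szg.
apply: leq_trans (dvdp_leq q0 hq).
have [h1 _] := irr; rewrite -(prednK (ltnW h1)) ltnS.
by apply: dvdn_leq dvd82; rewrite -ltnS prednK // ltnW.
Qed.

(** * Gauss's lemma at the place above 11 *)

(** The norm of Q(th) over Q, product of the three conjugates; [cbrt2_adj] is the product of the two
    conjugates other than x. *)
Definition cbrt2_norm (x : Zcbrt2) : Z :=
  let: ZC a b c := x in
  (a * a * a + 2 * (b * b * b) + 4 * (c * c * c) - 6 * (a * b * c))%coqZ.

Definition cbrt2_adj (x : Zcbrt2) : Zcbrt2 :=
  let: ZC a b c := x in
  ZC (a * a - 2 * (b * c)) (2 * (c * c) - a * b) (b * b - a * c).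

Lemma ZC_mulE (a b c a' b' c' : Z) :
  ZC a b c * ZC a' b' c' = Zcbrt2_mul (ZC a b c) (ZC a' b' c').
Proof. by []. Qed.

Lemma mul_adj x : x * cbrt2_adj x = ZC (cbrt2_norm x) 0 0.
Proof.
case: x => a b c; rewrite ZC_mulE /=.
by apply: ZC_eq; rewrite /= ?Z.double_spec; lia.
Qed.

Lemma cbrt2_normM x y :
  cbrt2_norm (x * y) = (cbrt2_norm x * cbrt2_norm y)%coqZ.
Proof.
case: x y => [a b c] [a' b' c']; rewrite ZC_mulE /= !Z.double_spec; lia.
Qed.

(* Infinite descent on the parity of the coordinates. *)
Lemma cbrt2_norm_eq0 x : cbrt2_norm x = 0%coqZ -> x = 0.
Proof.
suff descent n a b c : (Z.abs a + Z.abs b + Z.abs c < Z.of_nat n)%coqZ ->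
    (a * a * a + 2 * (b * b * b) + 4 * (c * c * c) - 6 * (a * b * c) = 0)%coqZ ->
    a = 0%coqZ /\ b = 0%coqZ /\ c = 0%coqZ.
  case: x => a b c e.
  have [|-> [-> ->] //] :=
    descent (Z.to_nat (Z.abs a + Z.abs b + Z.abs c + 1)) a b c _ e.
  lia.
have parity z : exists w, z = (2 * w)%coqZ \/ z = (2 * w + 1)%coqZ.
  by have [[w ->]|[w ->]] := Z.Even_or_Odd z; exists w; [left|right].
elim: n a b c => [|n IH] a b c lt_n e; first lia.
have [a' [Ea|Ea]] := parity a; last first.
  (* For a odd the norm would be odd. Halving the equation then exposes the parity of b, and halving
     again that of c. *)
  have : (2 * (4 * (a' * a' * a') + 6 * (a' * a') + 3 * a' + b * b * b
    + 2 * (c * c * c) - 3 * (a * b * c)) + 1 = 0)%coqZ by rewrite Ea in e *; lia.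
  lia.
have {}e : (4 * (a' * a' * a') + b * b * b + 2 * (c * c * c) - 6 * (a' * b * c) = 0)%coqZ.
  by rewrite Ea in e; lia.
have [b' [Eb|Eb]] := parity b; last first.
  have : (2 * (4 * (b' * b' * b') + 6 * (b' * b') + 3 * b' + 2 * (a' * a' * a')
    + c * c * c - 3 * (a' * b * c)) + 1 = 0)%coqZ by rewrite Eb in e *; lia.
  lia.
have {}e : (2 * (a' * a' * a') + 4 * (b' * b' * b') + c * c * c
    - 6 * (a' * b' * c) = 0)%coqZ.
  by rewrite Eb in e; lia.
have [c' [Ec|Ec]] := parity c; last first.
  have : (2 * (4 * (c' * c' * c') + 6 * (c' * c') + 3 * c' + a' * a' * a'
    + 2 * (b' * b' * b') - 3 * (a' * b' * c)) + 1 = 0)%coqZ by rewrite Ec in e *; lia.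
  lia.
have {}e : (a' * a' * a' + 2 * (b' * b' * b') + 4 * (c' * c' * c')
    - 6 * (a' * b' * c') = 0)%coqZ.
  by rewrite Ec in e; lia.
have [] : (Z.abs a' + Z.abs b' + Z.abs c' < Z.of_nat n)%coqZ
  \/ (a = 0 /\ b = 0 /\ c = 0)%coqZ by lia.
  by move=> /IH/(_ e); lia.
by [].
Qed.

(* A generator of the kernel of [rho11], of norm 11. *)
Definition pi11 := ZC 3 (-2) 0.

(* The quotient of x by pi11 when 11 divides [rhoZ x]; junk otherwise. *)
Definition div_pi11 (x : Zcbrt2) : Zcbrt2 :=
  let: ZC a b c := x in let k := Z.div (rhoZ x) 11 in
  ZC (9 * k - 5 * b - 39 * c) (6 * k - 3 * b - 26 * c) (4 * k - 2 * b - 17 * c).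

(** The cofactor of [pi11] in 11 is 9 + 6 th + 4 th^2. Multiplying x by it, substituting a = 11 k -
    7 b - 49 c and dividing by 11 gives the coefficients of [div_pi11]. *)
Lemma rho11_eq0 x : rho11 x = 0 -> x = pi11 * div_pi11 x.
Proof.
move=> rx; have {rx} : (Z.modulo (rhoZ x) 11 = 0)%coqZ.
  move: rx; rewrite /rho11 -(phi_mod _ F11).
  have := Z.mod_pos_bound (rhoZ x) 11 erefl; move: (Z.modulo _ _) => m mb.
  have : (m = 0 \/ m = 1 \/ m = 2 \/ m = 3 \/ m = 4 \/ m = 5 \/ m = 6 \/ m = 7
    \/ m = 8 \/ m = 9 \/ m = 10)%coqZ by lia.
  by do ?[case]=> ->.
case: x => a b c; rewrite /div_pi11 ZC_mulE; set r := rhoZ _ => r11.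
have Er : r = (a + 7 * b + 49 * c)%coqZ by [].
have := Z.div_mod r 11 (fun e => ltac:(discriminate e)); rewrite r11.
move: (Z.div _ _) => k rk.
by apply: ZC_eq; rewrite ?Z.double_spec; lia.
Qed.

Lemma map_rho11_eq0 (U : {poly Zcbrt2}) :
  map_poly rho11 U = 0 -> exists V, U = pi11 *: V.
Proof.
move=> rU; exists (\poly_(i < size U) div_pi11 U`_i); apply/polyP=> i.
rewrite coefZ coef_poly; case: ltnP => [_|szU]; last by rewrite mulr0 nth_default.
by apply: rho11_eq0; rewrite -coef_map rU coef0.
Qed.

Section Embedding.
Variables (R : realFieldType) (th : R).
Hypothesis th3 : th ^+ 3 = 2%:R.
Local Notation phi := (of_Z R).

(** The proof of th^3 = 2 is an argument so that the map can carry a ring morphism structure. *)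
Definition of_Zcbrt2 of th ^+ 3 = 2%:R := fun x : Zcbrt2 =>
  let: ZC a b c := x in phi a + phi b * th + phi c * th ^+ 2.
Arguments of_Zcbrt2 : simpl never.
Local Notation iota := (of_Zcbrt2 th3).

Lemma of_Z_inj : injective phi.
Proof.
move=> x y /= /eqP; rewrite eqr_int => /eqP; exact: can_inj int_of_ZK _ _.
Qed.

Lemma of_Zcbrt2_zmod : zmod_morphism iota.
Proof.
case=> [a b c] [a' b' c'].
have -> : ZC a b c - ZC a' b' c' = ZC (a - a') (b - b') (c - c') by [].
by rewrite /of_Zcbrt2; rewrite !rmorphB; ring.
Qed.

Lemma of_Zcbrt2_monoid : monoid_morphism iota.
Proof.
split; first by rewrite -[1]/(ZC 1 0 0) /of_Zcbrt2 rmorph1 rmorph0 !mul0r !addr0.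
case=> [a b c] [a' b' c']; rewrite ZC_mulE /of_Zcbrt2 /Zcbrt2_mul.
rewrite !Z.double_spec.
rewrite !(rmorphD phi) !(rmorphM phi) !(rmorphD phi) !(rmorphM phi).
rewrite -[phi 2%coqZ]/(2%:R : R).
ring: th3.
Qed.

HB.instance Definition _ := GRing.isZmodMorphism.Build Zcbrt2 R iota of_Zcbrt2_zmod.
HB.instance Definition _ := GRing.isMonoidMorphism.Build Zcbrt2 R iota of_Zcbrt2_monoid.

Lemma of_Zcbrt2_const n : iota (ZC n 0 0) = phi n.
Proof. by rewrite /of_Zcbrt2 !rmorph0 !mul0r !addr0. Qed.

(** The norm is a multiple of x, so an element of the kernel has norm 0. *)
Lemma of_Zcbrt2_inj : injective iota.
Proof.
apply: raddf_inj => x x0; apply: cbrt2_norm_eq0; apply: of_Z_inj.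
have := rmorphM iota x (cbrt2_adj x).
by rewrite /= mul_adj of_Zcbrt2_const x0 mul0r rmorph0.
Qed.

Local Notation "U ^io" := (map_poly iota U) (at level 2).

Lemma size_map_of_Zcbrt2 (U : {poly Zcbrt2}) : size (U^io) = size U.
Proof. by rewrite size_map_inj_poly ?rmorph0 //; apply: of_Zcbrt2_inj. Qed.

(** Cancellation is inherited from the field R through the embedding. *)
Lemma scale_pi11_inj (U V : {poly Zcbrt2}) : pi11 *: U = pi11 *: V -> U = V.
Proof.
move=> e; apply: (map_inj_poly of_Zcbrt2_inj); rewrite ?rmorph0 //.
have := congr1 (map_poly iota) e; rewrite !map_polyZ.
apply: scalerI; rewrite raddf_eq0 //; exact: of_Zcbrt2_inj.
Qed.

(* When [rho11 d] vanishes, [pi11] divides [d] and one of the two factors. *)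
Lemma gauss_place11 (G Q U : {poly Zcbrt2}) d :
    irreducible_poly (map_poly rho11 G) -> size (map_poly rho11 G) = size G ->
    d != 0 -> d *: G = Q * U ->
  (size Q <= 1)%N || (size U <= 1)%N.
Proof.
move=> irr szG; have [n] := ubnP (Z.abs_nat (cbrt2_norm d)).
elim: n d Q U => // n IH d Q U ltn d0 E.
have rE : rho11 d *: map_poly rho11 G = map_poly rho11 Q * map_poly rho11 U.
  by rewrite -map_polyZ E rmorphM.
have [rd|rd] := eqVneq (rho11 d) 0; last first.
  (* Here the reduction keeps the degree of the product and cannot raise that of a factor. By
     irreducibility one reduced factor has full degree, which leaves the other factor constant. *)
  have szQU : (size Q + size U)%N = (size G).+1.
    have eR : iota d *: G^io = Q^io * U^io by rewrite -map_polyZ E rmorphM.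
    have G0 : G^io != 0.
      by rewrite -size_poly_gt0 size_map_of_Zcbrt2 -szG (leq_trans _ irr.1).
    have d0' : iota d != 0 by rewrite raddf_eq0 //; apply: of_Zcbrt2_inj.
    have QU0 : Q^io * U^io != 0 by rewrite -eR scaler_eq0 negb_or d0'.
    move: QU0 eR; rewrite mulf_eq0 negb_or => /andP[Q0 U0].
    move=> /(congr1 (size \o val)) /=.
    rewrite size_scale // size_mul // !size_map_of_Zcbrt2 => ->; rewrite prednK //.
    by rewrite addn_gt0 -(size_map_of_Zcbrt2 Q) size_poly_gt0 Q0.
  have leQ : (size (map_poly rho11 Q) <= size Q)%N by apply: size_poly.
  have leU : (size (map_poly rho11 U) <= size U)%N by apply: size_poly.
  have szqu : (size (map_poly rho11 Q * map_poly rho11 U)%R = size G)%N.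
    by rewrite -rE size_scale // szG.
  have uG : map_poly rho11 U %| map_poly rho11 G.
    by rewrite -(dvdpZr _ _ rd) rE dvdp_mull.
  have [u1|u1] := eqVneq (size (map_poly rho11 U)) 1%N; last first.
    have /eqp_size := irr.2 _ u1 uG; rewrite szG => u_G; rewrite u_G in leU.
    by apply/orP; left; rewrite -(leq_add2r (size U)) szQU add1n ltnS.
  have := size_mul_leq (map_poly rho11 Q) (map_poly rho11 U).
  rewrite szqu u1 addn1 /= => leG; apply/orP; right.
  by rewrite -(leq_add2l (size Q)) szQU addn1 ltnS (leq_trans leG).
have dE := rho11_eq0 rd.
set d' := div_pi11 d in dE.
have d'0 : d' != 0 by apply: contra_neq d0; rewrite dE => ->; rewrite mulr0.
(* Removing [pi11], of norm 11, from d lowers the induction measure. *)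
have ltd' : (Z.abs_nat (cbrt2_norm d') < n)%N.
  have : cbrt2_norm d' <> 0%coqZ by move/cbrt2_norm_eq0/eqP; apply/negP.
  move: ltn; rewrite dE cbrt2_normM -[cbrt2_norm pi11]/11%coqZ.
  by move: (cbrt2_norm d') => m; lia.
move: rE; rewrite rd scale0r => /esym/eqP.
rewrite mulf_eq0 => /orP[] /eqP /map_rho11_eq0[V VE].
  have /(IH _ _ _ ltd' d'0) : d' *: G = V * U.
    by apply: scale_pi11_inj; rewrite scalerA -dE E VE scalerAl.
  case/orP=> [V1|->]; last by rewrite orbT.
  by rewrite VE (leq_trans (size_scale_leq _ _) V1).
have /(IH _ _ _ ltd' d'0) : d' *: G = Q * V.
  by apply: scale_pi11_inj; rewrite scalerA -dE E VE scalerAr.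
case/orP=> [->|V1] //.
by rewrite VE (leq_trans (size_scale_leq _ _) V1) orbT.
Qed.

(* Minimality of [U] makes the pseudo-remainder of [G] by [U] vanish. *)
Lemma size_annihilator_ge (G U : {poly Zcbrt2}) (k : R) :
    irreducible_poly (map_poly rho11 G) -> size (map_poly rho11 G) = size G ->
    root (G^io) k -> U != 0 -> root (U^io) k ->
  (size G <= size U)%N.
Proof.
move=> irr szG rootG.
have [n] := ubnP (size U); elim: n U => // n IH U ltn U0 rootU.
have U1 : (1 < size U)%N.
  rewrite ltnNge; apply/negP => /size1_polyC UE; move: rootU U0.
  rewrite UE map_polyC rootC polyC_eq0 /= raddf_eq0 => [->//|]; exact: of_Zcbrt2_inj.
have E := Pdiv.ComRing.rdivp_eq U G.
set r := Pdiv.Ring.rmodp G U in E; set q := Pdiv.Ring.rdivp G U in E.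
have ltr : (size r < size U)%N by rewrite Pdiv.Ring.ltn_rmodp.
have [r0|r0] := eqVneq r 0; last first.
  have : (size G <= size r)%N.
    apply: IH r0 _; first by rewrite (leq_trans ltr).
    have -> : r = lead_coef U ^+ Pdiv.Ring.rscalp G U *: G - q * U.
      by rewrite E addrC addKr.
    rewrite rmorphB rmorphM /= map_polyZ rootE hornerD hornerN hornerZ hornerM.
    by rewrite (rootP rootG) (rootP rootU) !mulr0 subrr.
  by move/leq_trans; apply; apply: ltnW.
have d0 : lead_coef U ^+ Pdiv.Ring.rscalp G U != 0.
  rewrite -(inj_eq of_Zcbrt2_inj) rmorph0 rmorphXn expf_neq0 //.
  by rewrite raddf_eq0 ?lead_coef_eq0 //; apply: of_Zcbrt2_inj.
rewrite r0 addr0 in E.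
have /orP[q1|] := gauss_place11 irr szG d0 E; last by rewrite leqNgt U1.
(* Since U is not constant, q is; then d G = q U bounds the size of G by that of U. *)
have /(congr1 (map_poly iota)) := E; rewrite map_polyZ rmorphM /=.
move=> /(congr1 (size \o val)) /=.
rewrite size_scale; last by rewrite raddf_eq0 //; apply: of_Zcbrt2_inj.
rewrite size_map_of_Zcbrt2 => ->; apply: leq_trans (size_mul_leq _ _) _.
by rewrite !size_map_of_Zcbrt2; move: q1; case: (size q) => [|[]] //; rewrite leq_pred.
Qed.

End Embedding.

(** * Norms to Z[X] *)

Lemma zc0_zmod : zmod_morphism zc0. Proof. by case=> ? ? ? [? ? ?]. Qed.
Lemma zc1_zmod : zmod_morphism zc1. Proof. by case=> ? ? ? [? ? ?]. Qed.
Lemma zc2_zmod : zmod_morphism zc2. Proof. by case=> ? ? ? [? ? ?]. Qed.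
HB.instance Definition _ := GRing.isZmodMorphism.Build Zcbrt2 Z zc0 zc0_zmod.
HB.instance Definition _ := GRing.isZmodMorphism.Build Zcbrt2 Z zc1 zc1_zmod.
HB.instance Definition _ := GRing.isZmodMorphism.Build Zcbrt2 Z zc2 zc2_zmod.

Lemma zc0M x y : zc0 (x * y) = zc0 x * zc0 y + (zc1 x * zc2 y + zc2 x * zc1 y) *+ 2.
Proof.
case: x y => [a b c] [a' b' c']; rewrite ZC_mulE /= Z.double_spec.
by rewrite -mulr_natl.
Qed.

Lemma zc1M x y : zc1 (x * y) = zc0 x * zc1 y + zc1 x * zc0 y + (zc2 x * zc2 y) *+ 2.
Proof.
case: x y => [a b c] [a' b' c']; rewrite ZC_mulE /= Z.double_spec.
by rewrite -mulr_natl.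
Qed.

Lemma zc2M x y : zc2 (x * y) = zc0 x * zc2 y + zc1 x * zc1 y + zc2 x * zc0 y.
Proof. by case: x y => [a b c] [a' b' c']. Qed.

(** The norm from Z[th][X] to Z[X], with A^3 set apart because it alone yields the leading term when
    A has the largest degree. *)
Definition norm_poly (U : {poly Zcbrt2}) : {poly Z} :=
  let A := map_poly zc0 U in let B := map_poly zc1 U in let C := map_poly zc2 U in
  A ^+ 3 + (B ^+ 3 *+ 2 + C ^+ 3 *+ 4 - (A * B * C) *+ 6).

Lemma norm_polyM U V : norm_poly (U * V) = norm_poly U * norm_poly V.
Proof.
have E0 : map_poly zc0 (U * V) = map_poly zc0 U * map_poly zc0 V +
    (map_poly zc1 U * map_poly zc2 V + map_poly zc2 U * map_poly zc1 V) *+ 2.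
  apply/polyP=> i; rewrite coefD coefMn coefD !coefM coef_map coefM raddf_sum /=.
  rewrite -big_split -sumrMnl -big_split /=.
  by apply: eq_bigr => j _; rewrite zc0M !coef_map.
have E1 : map_poly zc1 (U * V) = map_poly zc0 U * map_poly zc1 V +
    map_poly zc1 U * map_poly zc0 V + (map_poly zc2 U * map_poly zc2 V) *+ 2.
  apply/polyP=> i; rewrite 2!coefD coefMn !coefM coef_map coefM raddf_sum /=.
  rewrite -sumrMnl -!big_split /=.
  by apply: eq_bigr => j _; rewrite zc1M !coef_map.
have E2 : map_poly zc2 (U * V) = map_poly zc0 U * map_poly zc2 V +
    map_poly zc1 U * map_poly zc1 V + map_poly zc2 U * map_poly zc0 V.
  apply/polyP=> i; rewrite !coefD !coefM coef_map coefM raddf_sum /=.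
  rewrite -!big_split /=.
  by apply: eq_bigr => j _; rewrite zc2M !coef_map.
rewrite /norm_poly E0 E1 E2; ring.
Qed.

Lemma norm_polyC c : norm_poly c%:P = (cbrt2_norm c)%:P.
Proof.
rewrite /norm_poly !map_polyC /=; case: c => a b c /=.
rewrite -!rmorphXn -!rmorphM -!rmorphMn -!rmorphN -!rmorphD; congr (_%:P).
rewrite -(mulr_natl (b ^+ 3)) -(mulr_natl (c ^+ 3)) -(mulr_natl (a * b * c)).
rewrite -[2%:R]/2%coqZ -[4%:R]/4%coqZ -[6%:R]/6%coqZ /cbrt2_norm; lia.
Qed.

Lemma ZtoC_zmod : zmod_morphism ZtoC. Proof. by []. Qed.
HB.instance Definition _ := GRing.isZmodMorphism.Build Z Zcbrt2 ZtoC ZtoC_zmod.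

Lemma norm_poly_Z (f : {poly Z}) : norm_poly (map_poly ZtoC f) = f ^+ 3.
Proof.
have E0 : map_poly zc0 (map_poly ZtoC f) = f.
  by apply/polyP => i; rewrite !coef_map.
have E1 : map_poly zc1 (map_poly ZtoC f) = 0.
  by apply/polyP => i; rewrite !coef_map coef0.
have E2 : map_poly zc2 (map_poly ZtoC f) = 0.
  by apply/polyP => i; rewrite !coef_map coef0.
by rewrite /norm_poly E0 E1 E2; ring.
Qed.

Section Conjugates.
Variables (R : realFieldType) (th : R) (th3 : th ^+ 3 = 2%:R).
Local Notation iota := (of_Zcbrt2 th3).
Local Notation phi := (of_Z R).

(** U divides its norm over R; the cofactor is the formula of [cbrt2_adj] applied to the coordinate
    polynomials. *)
Lemma norm_poly_root (U : {poly Zcbrt2}) k :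
  root (map_poly iota U) k -> root (map_poly phi (norm_poly U)) k.
Proof.
pose A := map_poly phi (map_poly zc0 U); pose B := map_poly phi (map_poly zc1 U).
pose C := map_poly phi (map_poly zc2 U).
have T3 : th%:P ^+ 3 = 2%:R :> {poly R} by rewrite -rmorphXn th3 rmorph_nat.
have -> : map_poly iota U = A + th%:P * B + th%:P ^+ 2 * C.
  apply/polyP=> i; rewrite -rmorphXn !mul_polyC !coefD !coefZ !coef_map /=.
  by case: (U`_i) => a b c; rewrite /of_Zcbrt2 /=; ring.
have -> : map_poly phi (norm_poly U) = (A + th%:P * B + th%:P ^+ 2 * C) *
     ((A ^+ 2 - 2%:R * B * C) + (2%:R * C ^+ 2 - A * B) * th%:P
       + (B ^+ 2 - A * C) * th%:P ^+ 2).
  rewrite /norm_poly rmorphD rmorphB rmorphD !rmorphMn !rmorphXn !rmorphM /=.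
  rewrite -/A -/B -/C; ring: T3.
by rewrite rootM => ->.
Qed.

(** Pseudo-division gives c f = q G + r, where r vanishes at k and has degree below that of G, so r
    = 0. Norms turn this into N(c) f^3 = N(q) N(G), with N(c) a nonzero integer. *)
Lemma dvd_norm_poly (G : {poly Zcbrt2}) (f : {poly Z}) (k : R) :
    irreducible_poly (map_poly rho11 G) -> size (map_poly rho11 G) = size G ->
    root (map_poly iota G) k -> root (map_poly phi f) k ->
  map_poly (of_Z rat) (norm_poly G) %| map_poly (of_Z rat) f ^+ 3.
Proof.
move=> irr szG rootG rootf.
have G0 : G != 0 by rewrite -size_poly_gt0 -szG (leq_trans _ irr.1).
set fC := map_poly ZtoC f.
have fCE : map_poly iota fC = map_poly phi f.
  by apply/polyP => i; rewrite !coef_map; apply: of_Zcbrt2_const.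
have E := Pdiv.ComRing.rdivp_eq G fC.
set r := Pdiv.Ring.rmodp fC G in E; set q := Pdiv.Ring.rdivp fC G in E.
set c := lead_coef G ^+ _ in E.
have r0 : r = 0.
  apply/eqP/negP => /negP r0.
  have := Pdiv.Ring.ltn_rmodp fC G; rewrite G0 ltnNge => /negP; apply.
  apply: (size_annihilator_ge irr szG rootG r0).
  have -> : r = c *: fC - q * G by rewrite E addrC addKr.
  rewrite rmorphB rmorphM /= map_polyZ fCE rootE hornerD hornerN hornerZ hornerM.
  by rewrite (rootP rootG) (rootP rootf) !mulr0 subrr.
have c0 : c != 0.
  rewrite -(inj_eq (@of_Zcbrt2_inj _ _ th3)) rmorph0 rmorphXn expf_neq0 //.
  by rewrite raddf_eq0 ?lead_coef_eq0 //; apply: of_Zcbrt2_inj.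
have := congr1 norm_poly E.
rewrite r0 addr0 -mul_polyC !norm_polyM norm_polyC norm_poly_Z.
move/(congr1 (map_poly (of_Z rat))).
rewrite [LHS]rmorphM rmorphXn [RHS]rmorphM /= map_polyC /=.
move=> Er; rewrite -(@dvdpZr _ ((of_Z rat) (cbrt2_norm c))); last first.
  rewrite raddf_eq0; last exact: of_Z_inj.
  by apply: contra_neq c0; apply: cbrt2_norm_eq0.
by rewrite -mul_polyC Er dvdp_mull.
Qed.
End Conjugates.

Lemma lead_norm_poly (D : idomainType) (A B C : {poly D}) : (0 < size A)%N ->
    (size B < size A)%N -> (size C < size A)%N ->
  let N := A ^+ 3 + (B ^+ 3 *+ 2 + C ^+ 3 *+ 4 - (A * B * C) *+ 6) in
  size N = ((size A).-1 * 3).+1 /\ lead_coef N = lead_coef A ^+ 3.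
Proof.
move=> A0 ltB ltC /=.
have szA3 : size (A ^+ 3) = ((size A).-1 * 3).+1.
  by rewrite -(size_exp A 3) prednK // size_poly_gt0 expf_neq0 // -size_poly_gt0.
have szX (P : {poly D}) : (size P < size A)%N -> (size (P ^+ 3) <= (size A).-1 * 3)%N.
  move=> ltP; have [->|P0] := eqVneq P 0; first by rewrite expr0n size_poly0.
  have : (size (P ^+ 3)).-1 = ((size P).-1 * 3)%N by rewrite size_exp.
  have : (0 < size P)%N by rewrite size_poly_gt0.
  lia.
have szMn (P : {poly D}) n m : (size P <= n)%N -> (size (P *+ m) <= n)%N.
  by move=> szP; rewrite -scaler_nat (leq_trans (size_scale_leq _ _)).
have ltR : (size (B ^+ 3 *+ 2 + C ^+ 3 *+ 4 - (A * B * C) *+ 6)%R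
   < size (A ^+ 3)%R)%N.
  rewrite szA3 ltnS (leq_trans (size_polyD _ _)) // size_polyN geq_max.
  rewrite (leq_trans (size_polyD _ _)) ?geq_max ?szMn ?szX //=.
  apply: leq_trans (size_mul_leq _ _) _; have := size_mul_leq A B.
  move: (size (A * B)) (size A) (size B) (size C) A0 ltB ltC => x a b c.
  lia.
by rewrite size_polyDl // lead_coefDl // lead_coef_exp szA3.
Qed.

(** * The norm of G and the degree of the roots of G *)

Definition Gpoly := Poly G_seq.

Lemma size_G : size Gpoly = 83%N.
Proof. by rewrite (@PolyK _ 0). Qed.

Lemma norm_G_lead : size (norm_poly Gpoly) = 247%N /\
  lead_coef (norm_poly Gpoly) = (- (2 ^ 6 * 3 ^ 9))%coqZ ^+ 3.
Proof.
have szA : Poly (map zc0 G_seq) = map zc0 G_seq :> seq Z by rewrite (@PolyK _ 0).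
have small s : (forall i, (82 <= i)%N -> nth 0 s i = 0) -> (size (Poly s) < 83)%N.
  by move=> h; rewrite ltnS; apply/leq_sizeP => i /h; rewrite coef_Poly.
(* The top coefficient of G is an integer: its th and th^2 coordinates at index 82 are 0. *)
have szB : (size (Poly (map zc1 G_seq)) < 83)%N.
  by apply: small => i; rewrite leq_eqVlt => /orP[/eqP <- //|hi]; rewrite nth_default.
have szC : (size (Poly (map zc2 G_seq)) < 83)%N.
  by apply: small => i; rewrite leq_eqVlt => /orP[/eqP <- //|hi]; rewrite nth_default.
have lA : lead_coef (Poly (map zc0 G_seq)) = (- (2 ^ 6 * 3 ^ 9))%coqZ.
  by rewrite lead_coefE szA.
have sA : size (Poly (map zc0 G_seq)) = 83%N by rewrite szA.
rewrite /norm_poly /Gpoly !map_Poly -lA.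
move: (Poly (map zc0 _)) (Poly (map zc1 _)) (Poly (map zc2 _)) sA szB szC => A B C sA.
rewrite -{1 2}sA => szB szC; have A0 : (0 < size A)%N by rewrite sA.
by have [-> ->] := lead_norm_poly A0 szB szC; rewrite sA.
Qed.

(** Evaluating the three coordinates at 1 before taking the norm avoids expanding a polynomial of
    degree 246. *)
Lemma norm_G_1 : (norm_poly Gpoly).[1] = (- (2 ^ 61 * 3 ^ 54 * 5 ^ 5))%coqZ.
Proof.
rewrite /norm_poly /Gpoly !map_Poly !(hornerD, hornerN, hornerMn, horner_exp, hornerM).
by rewrite !horner_Poly; vm_compute.
Qed.

(** Either m divides p and one factor m cancels on both sides, or p is coprime to the power of m
    that it divides, hence constant. *)
Lemma dvdp_irreducible_expP (F : fieldType) (m p : {poly F}) n :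
    irreducible_poly m -> p %| m ^+ n ->
  exists j, p %= m ^+ j.
Proof.
move=> irr; have m0 := irredp_neq0 irr.
elim: n p => [|n IH] p pm; first by exists 0%N; rewrite expr0 -size_poly_eq1 -dvdp1.
have [mp|mp] := boolP (m %| p); last first.
  exists 0%N; rewrite expr0 -size_poly_eq1 -dvdp1.
  have cop : coprimep p (m ^+ n.+1).
    rewrite coprimep_sym coprimep_pexpl //.
    by rewrite irreducible_poly_coprime.
  by rewrite -(Gauss_dvdpl _ cop) mul1r.
move: mp pm => /dvdpP[q ->]; rewrite exprSr dvdp_mul2r // => /IH[j pj].
by exists j.+1; rewrite exprSr eqp_mul2r.
Qed.

Lemma map_of_Z_int (R : realFieldType) (q : {poly int}) :
  map_poly (of_Z R) (map_poly Z_of_int q) = map_poly intr q.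
Proof.
apply/polyP=> i; rewrite !coef_map /=; congr _%:~R; exact: Z_of_intK.
Qed.

Lemma ex_minimal_polynomial (R : realType) (x : R) (f : {poly rat}) :
    f != 0 -> root (map_poly ratr f) x ->
  exists m, minimal_polynomial x m.
Proof.
move=> f0 rf.
pose P n := `[< exists q : {poly rat},
  [/\ q != 0, root (map_poly ratr q) x & size q = n] >].
have exP : exists n, P n by exists (size f); apply/asboolP; exists f.
have [n /asboolP[q [q0 rq szq]] minq] := ex_minnP exP.
have lq : (lead_coef q)^-1 != 0 by rewrite invr_eq0 lead_coef_eq0.
exists ((lead_coef q)^-1 *: q); split.
- by rewrite monicE lead_coefZ mulVf // lead_coef_eq0.
- by rewrite map_polyZ rootE hornerZ (rootP rq) mulr0.
- move=> g g0 rg; rewrite size_scale // szq; apply: minq.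
  by apply/asboolP; exists g.
Qed.

Section MinimalPolynomial.
Variables (R : realType) (x : R) (m : {poly rat}).
Hypothesis hm : minimal_polynomial x m.

Lemma minimal_polynomial_neq0 : m != 0.
Proof. by have [/monic_neq0] := hm. Qed.

(** In a factorization of m, one factor vanishes at x and by minimality has full degree. *)
Lemma minimal_polynomial_irreducible : irreducible_poly m.
Proof.
have [mon rm minm] := hm; have m0 := minimal_polynomial_neq0.
split=> [|q q1 /dvdpP[r mE]].
  rewrite ltnNge; apply/negP => /size1_polyC mC; move: rm m0.
  by rewrite mC map_polyC rootC polyC_eq0 fmorph_eq0 => ->.
have /andP[r0 q0] : (r != 0) && (q != 0) by rewrite -negb_or -mulf_eq0 -mE.
have szm : size m = (size r + size q).-1 by rewrite mE size_mul.
rewrite mE rmorphM rootM in rm; have r1 : (0 < size r)%N by rewrite size_poly_gt0.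
have q2 : (1 < size q)%N by rewrite ltn_neqAle eq_sym q1 size_poly_gt0.
case/orP: rm => [/(minm _ r0)|/(minm _ q0)] le.
  move: le; rewrite szm -(prednK (ltnW q2)) addnS /= -{2}[size r]addn0.
  by rewrite leq_add2l leqNgt -ltnS prednK ?q2 // ltnW.
rewrite -dvdp_size_eqp ?mE ?dvdp_mull // -mE eqn_leq le andbT.
by rewrite dvdp_leq // mE dvdp_mull.
Qed.
End MinimalPolynomial.

(** The p-adic valuation of w is j times that of z, read off from numerator and denominator. *)
Lemma dvdn_logn_rat_exp (z : rat) (p w j : nat) : prime p -> (0 < w)%N ->
  z ^+ j = w%:R -> (j %| logn p w)%N.
Proof.
move=> pr w0 zj.
have E : (`|numq z| ^ j = `|denq z| ^ j * w)%N.
  rewrite -!abszX -[w]/(`|w%:Z|)%N -abszM; congr absz; apply/eqP.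
  rewrite -(eqr_int rat) rmorphM !rmorphXn /= -[w%:~R]/(w%:R) -zj.
  rewrite -{3}(divq_num_den z) expr_div_n mulrC divfK //.
  by rewrite expf_neq0 // intr_eq0 denq_neq0.
have d0 : (0 < `|denq z| ^ j)%N by rewrite expn_gt0 absz_gt0 denq_neq0.
have := congr1 (logn p) E; rewrite lognM // !lognX => e.
by rewrite -(dvdn_addr _ (dvdn_mulr (logn p `|denq z|) (dvdnn j))) -e dvdn_mulr.
Qed.

Lemma logn5_235 a b c : logn 5 (2 ^ a * 3 ^ b * 5 ^ c) = c.
Proof. by rewrite !lognM ?muln_gt0 ?expn_gt0 // !lognX !logn_prime //; lia. Qed.

Lemma natr235 (a b c : nat) : (2 ^ a * 3 ^ b * 5 ^ c)%:R
  = of_Z rat (2%coqZ ^+ a * 3%coqZ ^+ b * 5%coqZ ^+ c).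
Proof. by rewrite !natrM !natrX [RHS]rmorphM rmorphM !rmorphXn. Qed.

(** With the bases in [Z] and symbolic exponents, no huge natural number is computed in unary. *)
Lemma dvdn_rat_exp235 (z : rat) (j a b c : nat) :
  z ^+ j = of_Z rat (2%coqZ ^+ a * 3%coqZ ^+ b * 5%coqZ ^+ c) -> (j %| c)%N.
Proof.
rewrite -natr235 => /dvdn_logn_rat_exp => /(_ 5); rewrite logn5_235; apply=> //.
by rewrite !muln_gt0 !expn_gt0.
Qed.

Theorem degree_G_root (R : realType) (th : R) (th3 : th ^+ 3 = 2%:R) (k : R) :
    root (map_poly (of_Zcbrt2 th3) Gpoly) k ->
  exists p : {poly rat}, minimal_polynomial k p /\ (size p).-1 = 246%N.
Proof.
move=> rootG.
pose F := map_poly (of_Z rat) (norm_poly Gpoly).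
have [szN leadN] := norm_G_lead.
have szF : size F = 247%N.
  by rewrite size_map_inj_poly ?rmorph0 // ?szN //; apply: of_Z_inj.
have F0 : F != 0 by rewrite -size_poly_gt0 szF.
have ratrF (f : {poly Z}) :
    map_poly ratr (map_poly (of_Z rat) f) = map_poly (of_Z R) f.
  by rewrite -map_poly_comp; apply: eq_map_poly => z /=; rewrite ratr_int.
have rootF : root (map_poly ratr F) k.
  by rewrite ratrF; apply: norm_poly_root rootG.
have [m hm] := ex_minimal_polynomial F0 rootF.
have irr := minimal_polynomial_irreducible hm.
have [mon rm _] := hm.
exists m; split=> //.
have Fm : F %| m ^+ 3.
  (* Clearing denominators gives an integer polynomial vanishing at k. *)
  have [q [a a0 mE]] := rat_poly_scale m.
  pose f := map_poly Z_of_int q.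
  have fE : map_poly (of_Z rat) f = a%:~R *: m.
    by rewrite map_of_Z_int mE scalerA divff ?scale1r ?intr_eq0.
  have : F %| (a%:~R *: m) ^+ 3.
    rewrite -fE; apply: dvd_norm_poly rootG _.
    - exact: G_irreducible_mod11.
    - by rewrite size_G_mod11 size_G.
    - by rewrite -ratrF fE map_polyZ rootE hornerZ (rootP rm) mulr0.
  by rewrite exprZn dvdpZr // expf_neq0 // intr_eq0.
have [j /eqpP[[c1 c2] /= /andP[c10 c20] Fj]] := dvdp_irreducible_expP irr Fm.
pose c := c1^-1 * c2.
have FE : F = c *: m ^+ j by rewrite -scalerA -Fj scalerA mulVf ?scale1r.
have c0 : c != 0 by rewrite mulf_neq0 // invr_eq0.
have leadF : c = of_Z rat (lead_coef (norm_poly Gpoly)).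
  rewrite -lead_coef_map_inj ?rmorph0 -/F //; last exact: of_Z_inj.
  by rewrite FE lead_coefZ (monicP (monic_exp j mon)) mulr1.
have F1 : of_Z rat (norm_poly Gpoly).[1] = c * m.[1] ^+ j.
  by rewrite -horner_map rmorph1 -/F FE hornerZ horner_exp.
have val1 w : lead_coef (norm_poly Gpoly) * w = (norm_poly Gpoly).[1] ->
    m.[1] ^+ j = of_Z rat w.
  by move=> E; apply: (mulfI c0); rewrite -F1 -E leadF [LHS]rmorphM.
have j5 : (j %| 5)%N.
  (* This is the quotient of -2^61 3^54 5^5 by the leading coefficient -2^18 3^27; it equals
     m(1)^j. *)
  have E : lead_coef (norm_poly Gpoly) * (2%coqZ ^+ 43 * 3%coqZ ^+ 27 * 5%coqZ ^+ 5)
      = (norm_poly Gpoly).[1].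
    by rewrite leadN norm_G_1; vm_compute.
  exact: dvdn_rat_exp235 (val1 _ E).
have szj : ((size m).-1 * j)%N = 246%N.
  by rewrite -(size_exp m j) -(size_scale (m ^+ j) c0) -FE szF.
have j1 : j = 1%N.
  have j246 : (j %| 246)%N by rewrite -szj dvdn_mull.
  by apply/eqP; rewrite -dvdn1 -[1%N]/(gcdn 5 246) dvdn_gcd j5.
by move: szj; rewrite j1 muln1.
Qed.

(** * Elimination *)

Section SeqPow.
Variable B : comNzRingType.

Fixpoint seq_pow (s : seq B) n :=
  if n is n'.+1 then seq_mul s (seq_pow s n') else [:: 1].

Variables (A : comNzRingType) (phi : {rmorphism B -> A}) (x : A).

Lemma seq_eval_pow s n : seq_eval phi x (seq_pow s n) = seq_eval phi x s ^+ n.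
Proof.
elim: n => [|n IH] /=; first by rewrite rmorph1 mulr0 addr0.
by rewrite seq_eval_mul IH exprS.
Qed.

Lemma seq_eval_zero s : all (eq_op 0) s -> seq_eval phi x s = 0.
Proof.
by elim: s => //= c s IH /andP[/eqP<- /IH->]; rewrite rmorph0 mulr0 addr0.
Qed.

Lemma seq_eval_eq s t : all (eq_op 0) (seq_add s (seq_scale (-1) t)) ->
  seq_eval phi x s = seq_eval phi x t.
Proof.
move/seq_eval_zero/eqP; rewrite seq_eval_add seq_eval_scale rmorphN1 mulN1r subr_eq0.
by move/eqP.
Qed.

End SeqPow.

(* [(v, (i, j))] stands for v b^i c^j. Their sum D satisfies Res(q, q') = 81 c^9 D for the
   quintic q = ((1 + b t + c t^2)^3 - 1 - t^3) / t. *)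
Definition D_seq : seq (Z * (nat * nat)) :=
  [:: ((-3), (0%N, 2%N)); (132, (0%N, 5%N)); (48, (0%N, 8%N)); ((-4), (1%N, 0%N));
   (248, (1%N, 3%N)); (280, (1%N, 6%N)); (90, (2%N, 1%N)); (354, (2%N, 4%N));
   ((-12), (2%N, 7%N)); ((-90), (3%N, 2%N)); ((-168), (3%N, 5%N)); (9, (4%N, 0%N));
   ((-378), (4%N, 3%N)); (1, (4%N, 6%N)); (36, (5%N, 1%N)); (30, (5%N, 4%N)); (129, (6%N, 2%N));
   ((-6), (7%N, 0%N)); ((-2), (7%N, 3%N)); ((-18), (8%N, 1%N)); (1, (10%N, 0%N))]%coqZ.

(* The spurious solutions with zero error, where the parabola is tangent to the curve at k
   itself; up to t^2 (t - 1)^2 it is the norm over y of the equation b + c = th - 1. *)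
Definition E_seq : seq Zcbrt2 :=
  [:: ZC (-3) 3 0; ZC 4 (-6) 0; ZC 5 3 (-3); ZC (-6) 6 0; ZC 11 (-12) 0; ZC 4 6 (-6);
   ZC (-3) 3 0; ZC 6 (-6) 0; ZC 0 3 (-3)]%coqZ.

Definition eval_D (A : comNzRingType) (b c : A) : A :=
  \sum_(m <- D_seq) of_Z A m.1 * (b ^+ m.2.1 * c ^+ m.2.2).

(* With b t y^2 = y^3 - 2 y^2 + 1, c t^2 y^2 = y^2 - 1 and t^3 = y^3 - 1, this is
   t^16 y^20 D as a polynomial in y. *)
Definition D_on_curve :=
  foldr (fun '(v, (i, j)) => seq_add (seq_scale v
    (seq_mul (seq_pow [:: 1; 0; -2; 1]%coqZ i) (seq_mul (seq_pow [:: -1; 0; 1]%coqZ j)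
      (seq_mul (seq_pow [:: 0; 1]%coqZ (20 - (i + j).*2))
        (seq_pow [:: -1; 0; 0; 1]%coqZ ((16 - (i + j.*2)) %/ 3))))))) [::] D_seq.

Lemma D_on_curve0 : all (eq_op 0) D_on_curve. Proof. by vm_compute. Qed.

(** The hypotheses parametrize by the contact point (t, y) the parabolas 1 + b t + c t^2 tangent to
    the curve. Along this family t^16 y^20 D is the polynomial [D_on_curve], which is zero. *)
Lemma eval_D_eq0 (F : fieldType) (b c t y : F) : t != 0 -> y != 0 ->
    t ^+ 3 = y ^+ 3 - 1 ->
    b * t * y ^+ 2 = (y - 1) * (y ^+ 2 - y - 1) ->
    c * t ^+ 2 * y ^+ 2 = y ^+ 2 - 1 ->
  eval_D b c = 0.
Proof.
move=> t0 y0 ty bE cE.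
apply: (mulfI (mulf_neq0 (expf_neq0 16 t0) (expf_neq0 20 y0))); rewrite mulr0.
rewrite -(seq_eval_zero (of_Z F) y D_on_curve0) /D_on_curve /eval_D.
(* After clearing the denominators of b^i c^j, the remaining power of t has exponent divisible by 3,
   so it is a power of t^3 = y^3 - 1. *)
have : all (fun m => [&& m.2.1 + m.2.2 <= 10, m.2.1 + m.2.2.*2 <= 16 &
   3 %| 16 - (m.2.1 + m.2.2.*2)])%N D_seq by [].
have c0 : of_Z F 0%coqZ = 0 by [].
have c1 : of_Z F 1%coqZ = 1 by [].
have cN1 : of_Z F (-1)%coqZ = -1 by rewrite /= NegzE rmorphN.
have cN2 : of_Z F (-2)%coqZ = - 2%:R by rewrite /= NegzE rmorphN.
have y2E : seq_eval (of_Z F) y [:: 1; 0; -2; 1]%coqZ = b * t * y ^+ 2.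
  by rewrite bE /seq_eval /foldr c0 c1 cN2; ring.
have y1E : seq_eval (of_Z F) y [:: -1; 0; 1]%coqZ = c * t ^+ 2 * y ^+ 2.
  by rewrite cE /seq_eval /foldr c0 c1 cN1; ring.
have y3E : seq_eval (of_Z F) y [:: -1; 0; 0; 1]%coqZ = t ^+ 3.
  by rewrite ty /seq_eval /foldr c0 c1 cN1; ring.
have y4E : seq_eval (of_Z F) y [:: 0; 1]%coqZ = y.
  by rewrite /seq_eval /foldr c0 c1; ring.
move: (of_Z F) y1E y2E y3E y4E => phi y1E y2E y3E y4E.
elim: D_seq => [|[v [i j]] s IH] /=; first by rewrite big_nil mulr0.
case/andP=> /and3P[h1 h2 /dvdnP[q h3]] /IH {}IH.
rewrite big_cons mulrDr seq_eval_add -IH; congr (_ + _).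
rewrite seq_eval_scale !seq_eval_mul !seq_eval_pow y1E y2E y3E y4E h3 mulnK //.
have -> : t ^+ 16 = t ^+ i * (t ^+ 2) ^+ j * (t ^+ 3) ^+ q.
  by rewrite -!exprM -!exprD; congr (_ ^+ _); lia.
have -> : y ^+ 20 = (y ^+ 2) ^+ i * (y ^+ 2) ^+ j * y ^+ (20 - (i + j).*2).
  by rewrite -!exprM -!exprD; congr (_ ^+ _); lia.
move: (t ^+ 2) (t ^+ 3) (y ^+ 2) => t2 t3 y2; rewrite !exprMn.
move: (t ^+ i) (t2 ^+ j) (t3 ^+ q) (y2 ^+ i) (y2 ^+ j) (y ^+ (20 - _)).
by move: (b ^+ i) (c ^+ j) (phi v) => *; ring.
Qed.

(* [Yalg a0 a1 a2] is a0 + a1 y + a2 y^2 in the algebra y^3 = 1 + t^3 over Z[th][t]. *)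
Record yalg := Yalg { ya0 : seq Zcbrt2; ya1 : seq Zcbrt2; ya2 : seq Zcbrt2 }.

Definition Zser (s : seq Z) : seq Zcbrt2 := map ZtoC s.
Definition t3p1 := Zser [:: 1; 0; 0; 1]%coqZ.

Definition yadd u v :=
  let: Yalg a b c := u in let: Yalg a' b' c' := v in
  Yalg (seq_add a a') (seq_add b b') (seq_add c c').
Definition ymul u v :=
  let: Yalg a b c := u in let: Yalg a' b' c' := v in
  Yalg (seq_add (seq_mul a a')
      (seq_mul t3p1 (seq_add (seq_mul b c') (seq_mul c b'))))
    (seq_add (seq_add (seq_mul a b') (seq_mul b a')) (seq_mul t3p1 (seq_mul c c')))
    (seq_add (seq_add (seq_mul a c') (seq_mul b b')) (seq_mul c a')).
Definition yscale (z : Z) u :=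
  let: Yalg a b c := u in
  let z := ZtoC z in Yalg (seq_scale z a) (seq_scale z b) (seq_scale z c).
Fixpoint ypow u n :=
  if n is n'.+1 then ymul u (ypow u n') else Yalg (Zser [:: 1%coqZ]) [::] [::].
(** The norm over y: with T = 1 + t^3, it is a^3 + T b^3 + T^2 c^3 - 3 T a b c. *)
Definition ynorm u := let: Yalg a b c := u in
  seq_add (seq_mul a (seq_mul a a)) (seq_add (seq_mul t3p1 (seq_mul b (seq_mul b b)))
   (seq_add (seq_mul t3p1 (seq_mul t3p1 (seq_mul c (seq_mul c c))))
     (seq_scale (ZtoC (-3)%coqZ) (seq_mul t3p1 (seq_mul a (seq_mul b c)))))).

(* At the solution, b = By / Wy and c = Cy / Wy, and Dy = Wy^10 D. *)
Definition By := Yalg (Zser [:: 0; 2; 1; 0; 1]%coqZ) [::] [:: ZC 0 0 0; ZC 0 (-2) 0]%coqZ.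
Definition Cy := Yalg (Zser [:: -1; 0; -1]%coqZ) [::] [:: ZC 0 1 0]%coqZ.
Definition Wy := Yalg [::] [::] (Zser [:: 1; -2; 1]%coqZ).
Definition Dy := foldr (fun '(v, (i, j)) =>
  yadd (yscale v (ymul (ypow By i) (ymul (ypow Cy j) (ypow Wy (10 - (i + j)))))))
  (Yalg [::] [::] [::]) D_seq.

(** G is what remains of the norm of [Dy] after removing (t - 1)^20 (t + 1)^4 and E. The first two
    factors have no root in the open unit interval; a nonzero error excludes E. *)
Lemma ynorm_Dy : all (eq_op 0) (seq_add (ynorm Dy) (seq_scale (-1)
  (seq_mul (seq_pow (Zser [:: -1; 1]%coqZ) 20) (seq_mul (seq_pow (Zser [:: 1; 1]%coqZ) 4)
    (seq_mul E_seq G_seq))))).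
Proof. by vm_compute. Qed.

(** Multiplied by [Wy], the equation b + c = th - 1 becomes y^2 (th t^2 - (1 - t)^2) = t^4 + 2 t -
    1. The difference of the cubes of its sides, with y^6 = (1 + t^3)^2, is t^2 (t - 1)^2 E. *)
Lemma E_seq_tangent : all (eq_op 0) (seq_add
  (seq_mul (Zser [:: 0; 0; 1; -2; 1]%coqZ) E_seq) (seq_scale (-1)
  (seq_add (seq_mul (seq_pow t3p1 2) (seq_pow [:: ZC (-1) 0 0; ZC 2 0 0; ZC (-1) 1 0]%coqZ 3))
    (seq_scale (-1) (seq_pow (Zser [:: -1; 2; 0; 0; 1]%coqZ) 3))))).
Proof. by vm_compute. Qed.

Arguments of_Zcbrt2 : simpl never.
Arguments of_Z : simpl never.
Arguments seq_mul : simpl never.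
Arguments seq_add : simpl never.
Arguments seq_scale : simpl never.
Arguments Zser : simpl never.

Lemma of_Z_small (A : comNzRingType) : let phi := of_Z A in
  (phi 0%coqZ = 0) * (phi 1%coqZ = 1) * (phi 2%coqZ = 2%:R) *
  (phi (-1)%coqZ = -1) * (phi (-2)%coqZ = - 2%:R) * (phi (-3)%coqZ = - 3%:R).
Proof. by rewrite /of_Z /= !NegzE !rmorphN; do !split. Qed.

Section EvalY.
Variables (R : realFieldType) (th : R) (th3 : th ^+ 3 = 2%:R) (t y : R).
Hypothesis y3 : y ^+ 3 = 1 + t ^+ 3.
Local Notation ev := (seq_eval (of_Zcbrt2 th3) t).
Local Notation phi := (of_Z R).

Definition yev u := ev (ya0 u) + ev (ya1 u) * y + ev (ya2 u) * y ^+ 2.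

Lemma of_Zcbrt2_ZtoC z : of_Zcbrt2 th3 (ZtoC z) = phi z.
Proof. exact: of_Zcbrt2_const. Qed.

Lemma ev_Zser s : ev (Zser s) = seq_eval phi t s.
Proof.
elim: s => // c s IH.
by rewrite -[LHS]/(of_Zcbrt2 th3 (ZtoC c) + t * ev (Zser s)) IH of_Zcbrt2_ZtoC.
Qed.

Lemma ev_t3p1 : ev t3p1 = 1 + t ^+ 3.
Proof. by rewrite ev_Zser /seq_eval /foldr !of_Z_small; ring. Qed.

Lemma yev_add u v : yev (yadd u v) = yev u + yev v.
Proof. by case: u v => a b c [a' b' c']; rewrite /yev /= !seq_eval_add; ring. Qed.

Lemma yev_scale z u : yev (yscale z u) = phi z * yev u.
Proof.
by case: u => a b c; rewrite /yev [yscale _ _]/= !seq_eval_scale /= of_Zcbrt2_const; ring.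
Qed.

Lemma yev_mul u v : yev (ymul u v) = yev u * yev v.
Proof.
case: u v => a b c [a' b' c'].
rewrite /yev [ymul _ _]/= !(seq_eval_add, seq_eval_mul) ev_t3p1.
move: (ev a) (ev b) (ev c) (ev a') (ev b') (ev c') => *; ring: y3.
Qed.

Lemma yev_pow u n : yev (ypow u n) = yev u ^+ n.
Proof.
elim: n => [|n IH].
  rewrite /yev [ypow _ _]/= ev_Zser /seq_eval /foldr !of_Z_small.
  by rewrite !(mulr0, mul0r, addr0).
by rewrite yev_mul IH exprS.
Qed.

(** The norm is A^3 + (B y)^3 + (C y^2)^3 - 3 A (B y) (C y^2), which has A + B y + C y^2 as a
    factor. *)
Lemma yev_norm u : yev u = 0 -> ev (ynorm u) = 0.
Proof.
case: u => a b c; rewrite /yev [ynorm _]/= => u0.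
rewrite !(seq_eval_add, seq_eval_scale, seq_eval_mul) ev_t3p1 /= of_Zcbrt2_const.
rewrite !of_Z_small.
move: (ev a) (ev b) (ev c) u0 => A B C /= u0.
have -> : A * (A * A) + ((1 + t ^+ 3) * (B * (B * B)) +
    ((1 + t ^+ 3) * ((1 + t ^+ 3) * (C * (C * C))) +
     - 3%:R * ((1 + t ^+ 3) * (A * (B * C))))) =
  (A + B * y + C * y ^+ 2) * (A ^+ 2 + B ^+ 2 * y ^+ 2 + C ^+ 2 * y ^+ 4
    - A * B * y - A * C * y ^+ 2 - B * C * y ^+ 3) by ring: y3.
by rewrite u0 mul0r.
Qed.

Lemma of_Zcbrt2_ZC a b c :
  of_Zcbrt2 th3 (ZC a b c) = phi a + phi b * th + phi c * th ^+ 2.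
Proof. by []. Qed.

Lemma yev_B : yev By = t ^+ 4 + t ^+ 2 + 2%:R * t - 2%:R * t * th * y ^+ 2.
Proof.
have e : ev [:: ZC 0 0 0; ZC 0 (-2) 0]%coqZ = - 2%:R * th * t.
  by rewrite -[LHS]/(of_Zcbrt2 th3 (ZC 0 0 0) + t * (of_Zcbrt2 th3 (ZC 0 (-2) 0)%coqZ
    + t * 0)) !of_Zcbrt2_ZC !of_Z_small; ring.
rewrite /yev [ya0 _]/= [ya1 _]/= [ya2 _]/= e !ev_Zser /seq_eval /foldr !of_Z_small.
by ring.
Qed.

Lemma yev_C : yev Cy = th * y ^+ 2 - 1 - t ^+ 2.
Proof.
have e : ev [:: ZC 0 1 0]%coqZ = th.
  rewrite -[LHS]/(of_Zcbrt2 th3 (ZC 0 1 0)%coqZ + t * 0) !of_Zcbrt2_ZC !of_Z_small; ring.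
rewrite /yev [ya0 _]/= [ya1 _]/= [ya2 _]/= e !ev_Zser /seq_eval /foldr !of_Z_small.
by ring.
Qed.

Lemma yev_W : yev Wy = (1 - t) ^+ 2 * y ^+ 2.
Proof.
rewrite /yev [ya0 _]/= [ya1 _]/= [ya2 _]/= !ev_Zser /seq_eval /foldr !of_Z_small.
by ring.
Qed.

Lemma yev_D b c : yev By = b * yev Wy -> yev Cy = c * yev Wy ->
  yev Dy = yev Wy ^+ 10 * eval_D b c.
Proof.
move=> bE cE; rewrite /Dy /eval_D.
have : all (fun m => m.2.1 + m.2.2 <= 10)%N D_seq by [].
move: (of_Z R) yev_scale => phi yscaleE.
elim: D_seq => [|[v [i j]] s IH].
  by rewrite big_nil /yev /= !mul0r !addr0 mulr0.
rewrite [all _ _]/= => /andP[ij /IH {}IH]; rewrite big_cons mulrDr -IH.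
rewrite [foldr _ _ _]/= yev_add yscaleE !yev_mul !yev_pow bE cE; congr (_ + _).
have -> : yev Wy ^+ 10 = yev Wy ^+ i * yev Wy ^+ j * yev Wy ^+ (10 - (i + j)).
  by rewrite -!exprD; congr (_ ^+ _); lia.
by rewrite !exprMn; move: (yev Wy) => w; ring.
Qed.
End EvalY.

Lemma cube_inj (R : realFieldType) (a b : R) : a ^+ 3 = b ^+ 3 -> a = b.
Proof.
move=> e; apply/eqP; rewrite -subr_eq0.
have : (a - b) * (a ^+ 2 + a * b + b ^+ 2) == 0 by apply/eqP; ring: e.
rewrite mulf_eq0 => /orP[//|/eqP q0].
have b2 : b ^+ 2 <= 0 by have := sqr_ge0 (2%:R * a + b); lra.
have b0 : b = 0 by apply/eqP; rewrite -sqrf_eq0 eq_le b2 sqr_ge0.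
have : a ^+ 2 == 0 by apply/eqP; move: q0; rewrite b0; lra.
by rewrite sqrf_eq0 b0 subr0.
Qed.

(** Tangency at k and the chord from k to 1 are linear in b and c, with solution [By] / [Wy] and
    [Cy] / [Wy]; tangency at t2 gives D = 0. So the norm of [Dy] vanishes at k, and all its factors
    but G are excluded. *)
Lemma root_G (R : realFieldType) (th : R) (th3 : th ^+ 3 = 2%:R)
    (k y b c t2 y2 : R) :
    0 < k -> k < 1 -> 0 < y -> y ^+ 3 = 1 + k ^+ 3 ->
    y ^+ 2 * (b + 2%:R * c * k) = k ^+ 2 ->
    b * (1 - k) + c * (1 - k ^+ 2) = th - y ->
    t2 != 0 -> y2 != 0 -> y2 ^+ 3 = 1 + t2 ^+ 3 ->
    1 + b * t2 + c * t2 ^+ 2 = y2 ->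
    y2 ^+ 2 * (b + 2%:R * c * t2) = t2 ^+ 2 ->
    b + c != th - 1 ->
  root (map_poly (of_Zcbrt2 th3) Gpoly) k.
Proof.
move=> k0 k1 y0 y3 tan1 chord1 t20 y20 y23 on2 tan2 nosym.
have cE2 : c * t2 ^+ 2 * y2 ^+ 2 = y2 ^+ 2 - 1.
  have e1 : (b * t2 + 2%:R * c * t2 ^+ 2) * y2 ^+ 2 = y2 ^+ 3 - 1.
    have /= := congr1 ( *%R t2) tan2; lra.
  have e2 : (b * t2 + c * t2 ^+ 2) * y2 ^+ 2 = (y2 - 1) * y2 ^+ 2.
    by congr (_ * _); lra.
  lra.
have bE2 : b * t2 * y2 ^+ 2 = (y2 - 1) * (y2 ^+ 2 - y2 - 1).
  have e2 : (b * t2 + c * t2 ^+ 2) * y2 ^+ 2 = (y2 - 1) * y2 ^+ 2.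
    by congr (_ * _); lra.
  lra.
have D0 : eval_D b c = 0.
  by apply: (eval_D_eq0 t20 y20) bE2 cE2; rewrite y23; ring.
have CE : th * y ^+ 2 - 1 - k ^+ 2 = c * ((1 - k) ^+ 2 * y ^+ 2).
  have /= := congr1 ( *%R^~ (y ^+ 2)) chord1.
  have /= := congr1 ( *%R^~ (1 - k)) tan1; lra.
have BE : k ^+ 4 + k ^+ 2 + 2%:R * k - 2%:R * k * th * y ^+ 2
    = b * ((1 - k) ^+ 2 * y ^+ 2).
  have /= := congr1 ( *%R^~ ((1 - k) ^+ 2)) tan1.
  have /= := congr1 ( *%R (2%:R * k)) CE; lra.
have : yev th3 k y Dy = 0.
  by rewrite (yev_D (b := b) (c := c) y3) ?D0 ?mulr0 ?yev_B ?yev_C ?yev_W.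
move/(yev_norm y3); rewrite (seq_eval_eq _ _ ynorm_Dy) seq_eval_mul seq_eval_pow ev_Zser.
rewrite seq_eval_mul seq_eval_pow ev_Zser seq_eval_mul rootE /Gpoly -seq_evalE.
move=> /eqP; rewrite mulf_eq0 expf_eq0 mulf_eq0 expf_eq0 mulf_eq0.
have -> : (seq_eval (of_Z R) k [:: -1; 1]%coqZ == 0) = false.
  apply/negbTE; rewrite /seq_eval /foldr !of_Z_small; lra.
have -> : (seq_eval (of_Z R) k [:: 1; 1]%coqZ == 0) = false.
  apply/negbTE; rewrite /seq_eval /foldr !of_Z_small; lra.
rewrite !andbF !orFb => /orP[/eqP E0|]; last by [].
(* If E vanishes at k, two cubes are equal; real cube roots are unique, so b + c = th - 1. *)
exfalso; move/eqP: nosym; apply.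
have := seq_eval_eq (of_Zcbrt2 th3) k E_seq_tangent.
rewrite [LHS]seq_eval_mul [X in _ * X = _]E0 [LHS]mulr0.
rewrite seq_eval_add seq_eval_scale seq_eval_mul 3!seq_eval_pow ev_t3p1 ev_Zser.
rewrite rmorphN1.
have -> : seq_eval (of_Zcbrt2 th3) k [:: ZC (-1) 0 0; ZC 2 0 0; ZC (-1) 1 0]%coqZ
   = th * k ^+ 2 - (1 - k) ^+ 2.
  by rewrite -[LHS]/(of_Zcbrt2 th3 (ZC (-1) 0 0)%coqZ + k * (of_Zcbrt2 th3 (ZC 2 0 0)%coqZ
    + k * (of_Zcbrt2 th3 (ZC (-1) 1 0)%coqZ + k * 0))) !of_Zcbrt2_ZC !of_Z_small; ring.
have -> : seq_eval (of_Z R) k [:: -1; 2; 0; 0; 1]%coqZ = k ^+ 4 + 2%:R * k - 1.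
  by rewrite /seq_eval /foldr !of_Z_small; ring.
rewrite -y3 => e.
have {}e : y ^+ 2 * (th * k ^+ 2 - (1 - k) ^+ 2) = k ^+ 4 + 2%:R * k - 1.
  apply: cube_inj; apply/eqP; rewrite -subr_eq0; apply/eqP.
  by rewrite [RHS]e; ring.
have W0 : (1 - k) ^+ 2 * y ^+ 2 != 0 by rewrite mulf_neq0 // expf_neq0 //; lra.
apply: (mulIf W0); rewrite mulrDl -BE -CE; lra.
Qed.

(** * The alternation conditions *)

Section Target.
Variable R : realType.
Implicit Types (t b c e : R) (h : {poly R}).

Lemma target_cube t : 0 <= t -> target t ^+ 3 = 1 + t ^+ 3.
Proof.
move=> t0; have t3 : 0 <= 1 + t ^+ 3 by rewrite addr_ge0 // exprn_ge0.
by rewrite -powR_mulrn ?powR_ge0 // /target -powRrM mulVf ?pnatr_eq0 // powRr1.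
Qed.

Lemma target_gt0 t : 0 <= t -> 0 < target t.
Proof. by move=> t0; rewrite powR_gt0 // ltr_wpDr // exprn_ge0. Qed.

Lemma target0 : target 0 = 1 :> R.
Proof. by rewrite /target expr0n addr0 powR1. Qed.

(* Cubing turns the comparison with [target] into one with a polynomial, which has an
   extremum at the contact point. *)
Lemma tangent_at_contact (s : bool) (a b c t0 : R) : 0 < t0 -> t0 < 1 ->
    (forall t, 0 <= t -> t <= 1 ->
      0 <= (-1) ^+ s * (a + b * t + c * t ^+ 2 - target t)) ->
    a + b * t0 + c * t0 ^+ 2 = target t0 ->
  target t0 ^+ 2 * (b + 2%:R * c * t0) = t0 ^+ 2.
Proof.
move=> t00 t01 side contact.
pose q := a%:P + b *: 'X + c *: 'X^2.
have qE t : q.[t] = a + b * t + c * t ^+ 2 by rewrite !hornerE.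
pose p := q ^+ 3 - 1 - 'X^3.
have pE t : p.[t] = q.[t] ^+ 3 - (1 + t ^+ 3).
  by rewrite /p 2!hornerD 2!hornerN horner_exp hornerXn hornerC; ring.
have p0 : p.[t0] = 0 by rewrite pE qE contact target_cube ?subrr // ltW.
have t0I : t0 \in `]0, 1[ by rewrite in_itv /= t00.
have der t : t \in `]0, 1[ -> derivable (horner p) t 1.
  by move=> _; apply: derivable_horner.
have sgp t : t \in `]0, 1[ -> 0 <= (-1) ^+ s * p.[t].
  rewrite in_itv /= => /andP[/ltW t_ge0 /ltW t_le1].
  have := side t t_ge0 t_le1; have y0 := target_gt0 t_ge0.
  rewrite pE -qE -target_cube //; move: q.[t] (target t) y0 => u v v0.
  case: s {side}; rewrite ?expr1 ?expr0 ?mul1r ?mulN1r ?oppr_ge0 ?subr_ge0 ?subr_le0.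
    (* The quadratic lies below the target and may be negative; its cube is then nonpositive. *)
    have [u0 uv|u0 _] := leP 0 u; first by rewrite lerXn2r // nnegrE ltW.
    by apply: le_trans (_ : 0 <= _); rewrite ?exprn_odd_le0 ?exprn_ge0 // ltW.
  by move=> vu; rewrite lerXn2r // nnegrE ?(le_trans _ vu) // ltW.
have der0 : is_derive t0 1 (horner p) 0.
  case: s {side} sgp; rewrite ?expr1 ?expr0 => sgp.
    apply: (derive1_at_max (a := 0) (b := 1)) => // t /sgp.
    by rewrite p0 mulN1r oppr_ge0.
  apply: (derive1_at_min (a := 0) (b := 1)) => // t /sgp.
  by rewrite p0 mul1r.
(* At the interior extremum, 3 q^2 q' = 3 t0^2. *)
have : p^`().[t0] = 0 by rewrite derivE derive1E derive_val.
have q'E : q^`().[t0] = b + 2%:R * c * t0.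
  rewrite /q 2!derivD derivC 2!derivZ derivX derivXn 2!hornerD !hornerZ hornerMn.
  by rewrite hornerC hornerC hornerX; ring.
have d1 : (1 : {poly R})^`() = 0 by exact: derivC.
rewrite /p 2!derivB deriv_exp derivXn d1 subr0 hornerD hornerN 2!hornerMn.
by rewrite hornerM horner_exp q'E qE contact hornerXn /=; lra.
Qed.

(* Six sample points determine the coefficients of ((1 + b t + c t^2)^3 - 1 - t^3) / t. *)
Lemma cube_not_quadratic b c :
  (forall t, 0 <= t -> t <= 1 -> (1 + b * t + c * t ^+ 2) ^+ 3 = 1 + t ^+ 3) -> False.
Proof.
move=> e.
have pt (n : nat) : (0 < n)%N -> let x : R := n%:R^-1 in
   3%:R * b + (3%:R * c + 3%:R * b ^+ 2) * x + (b ^+ 3 + 6%:R * b * c - 1) * x ^+ 2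
   + (3%:R * c ^+ 2 + 3%:R * b ^+ 2 * c) * x ^+ 3 + 3%:R * b * c ^+ 2 * x ^+ 4
   + c ^+ 3 * x ^+ 5 = 0.
  move=> n0 x; have x0 : x != 0 by rewrite invr_eq0 pnatr_eq0 -lt0n.
  apply: (mulfI x0); rewrite mulr0.
  have := e x; rewrite invr_ge0 ler0n invf_le1 ?ltr0n // ler1n n0 => /(_ isT isT).
  lra.
have := pt 1%N isT; have := pt 2 isT; have := pt 3 isT.
have := pt 4 isT; have := pt 5 isT; have := pt 6 isT; rewrite /= invr1.
(* As independent unknowns the coefficients solve an invertible linear system, so all vanish. Then b
   = 0, c = 0 and the coefficient [q2] is -1, a contradiction. *)
set q1 := 3%:R * c + _; set q2 := b ^+ 3 + _ - 1; set q3 := 3%:R * c ^+ 2 + _.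
set q4 := 3%:R * b * c ^+ 2; set q5 := c ^+ 3 => h6 h5 h4 h3 h2 h1.
have b0 : b = 0 by lra.
have : q1 = 0 by lra.
rewrite /q1 b0 => c0; have {}c0 : c = 0 by lra.
have : q2 = 0 by lra.
by rewrite /q2 b0 c0; lra.
Qed.

Lemma le_max_error h t : 0 <= t -> t <= 1 -> `|error h t| <= max_error h.
Proof.
move=> t0 t1; apply: ub_le_sup; last by exists t; rewrite //= in_itv /= t0.
(* The supremum needs a bound: the sum bounds h on the unit interval, and 2 bounds the target, whose
   cube is at most 2. *)
exists ((\sum_(i < size h) `|h`_i|) + 2%:R) => _ [u uI <-].
move: uI; rewrite /= in_itv /= => /andP[u0 u1].
apply: le_trans (ler_normB _ _) _; apply: lerD.
  rewrite horner_coef; apply: le_trans (ler_norm_sum _ _ _) _; apply: ler_sum => i _.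
  by rewrite normrM normrX (ger0_norm u0) ler_piMr // exprn_ile1.
have y0 := target_gt0 u0; have y3 := target_cube u0.
have u3 : u ^+ 3 <= 1 by rewrite exprn_ile1.
rewrite gtr0_norm // leNgt; apply/negP => y2.
have : 2%:R ^+ 3 < target u ^+ 3 by rewrite ltrXn2r // nnegrE ltW.
rewrite y3; lra.
Qed.

Lemma quadraticE h t : (size h <= 3)%N ->
  h.[t] = h`_0 + h`_1 * t + h`_2 * t ^+ 2.
Proof.
move=> sz; rewrite (horner_coef_wide _ sz) 3!big_ord_recl big_ord0 /=.
by rewrite expr0 mulr1 addr0 expr1 addrA.
Qed.
End Target.

Theorem theorem3 (R : realType) (h : {poly R}) (k : R)
    (hbest : best_quadratic h)
    (hk : first_interior_alternation_point h k) :
  exists p : {poly rat}, minimal_polynomial k p /\ (size p).-1 = 246%N.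
Proof.
have [szh _] := hbest.
have [t2 [s [[k0 kt2 t21] [e0 ek et2 e1]]]] := hk.
have lt1 := lt_trans k0 kt2.
set E := max_error h in e0 ek et2 e1.
pose e := (-1) ^+ s * E.
rewrite -/e in e0 ek et2 e1.
set b := h`_1; set c := h`_2.
have hE t : h.[t] = 1 + e + b * t + c * t ^+ 2.
  rewrite quadraticE // -/b -/c; congr (_ + _ + _).
  move: e0; rewrite /error target0 quadraticE // expr0n !mulr0 !addr0; lra.
have signE : (-1) ^+ s * e = E by rewrite /e mulrA -expr2 sqrr_sign mul1r.
have bound t : 0 <= t -> t <= 1 -> - E <= (-1) ^+ s * error h t <= E.
  by move=> t0 t1; rewrite -ler_norml normrM normr_sign mul1r le_max_error.
(* With zero error, the cube of a quadratic would equal 1 + t^3 on the interval. *)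
have e_neq0 : e != 0.
  apply/eqP => e00; apply: (@cube_not_quadratic R b c) => t t0 t1.
  have E0 : E = 0 by rewrite -signE e00 mulr0.
  have := le_max_error h t0 t1; rewrite -/E E0 normr_le0 /error subr_eq0 => /eqP.
  by rewrite hE e00 addr0 => ->; apply: target_cube.
pose th : R := target 1.
have th3 : th ^+ 3 = 2%:R by rewrite target_cube ?ler01 // expr1n.
have k1 : k < 1 := lt_trans kt2 t21.
have tan1 : target k ^+ 2 * (b + 2%:R * c * k) = k ^+ 2.
  (* The error at k is the extreme value -e, so h + e stays on one side of the target and touches it
     at k. *)
  apply: (@tangent_at_contact R s (1 + e + e)) => // [t t0 t1|].
    have := bound t t0 t1; rewrite /error hE => /andP[lb _].
    rewrite (_ : _ * _ = (-1) ^+ s * (1 + e + b * t + c * t ^+ 2 - target t)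
      + (-1) ^+ s * e); last by ring.
    by rewrite signE -lerBlDr sub0r.
  by move: ek; rewrite /error hE; lra.
have tan2 : target t2 ^+ 2 * (b + 2%:R * c * t2) = t2 ^+ 2.
  (* At t2 the error is e, so h - e touches the target from the opposite side. *)
  apply: (@tangent_at_contact R (~~ s) 1) => // [t t0 t1|].
    have := bound t t0 t1; rewrite /error hE => /andP[_ ub].
    rewrite (_ : _ * _ = (-1) ^+ s * e
      - (-1) ^+ s * (1 + e + b * t + c * t ^+ 2 - target t)).
      by rewrite signE subr_ge0.
    by rewrite signrN; ring.
  by move: et2; rewrite /error hE; lra.
apply: (degree_G_root (th3 := th3)).
apply: (@root_G _ _ th3 k (target k) b c t2 (target t2)) => //.
- by rewrite target_gt0 // ltW.
- by rewrite target_cube // ltW.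
(* The errors at k and 1 agree, so h and the target have equal increments between them. *)
- by move: ek e1; rewrite /error !hE /th; lra.
- by rewrite gt_eqF.
- by rewrite gt_eqF // target_gt0 // ltW.
- by rewrite target_cube // ltW.
- by move: et2; rewrite /error hE; lra.
(* If b + c = th - 1, the error at 1 is e; it is also -e, so e = 0. *)
- apply: contra_neq e_neq0 => bc; move: e1; rewrite /error hE -/th; lra.
Qed.
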